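(* Let $e_1,e_2,e_3$ be nonzero integers with $e_1+e_2+e_3=0$ and $\gcd(e_1,e_2,e_3)\in\{1,2\}$. Let $n=p_1\cdots p_k$ be an odd positive square-free integer coprime with $e_1e_2e_3$, whose prime factors $p_i$ are quadratic residues modulo each odd prime factor of $e_1e_2e_3$. Assume that neither $E$ nor $E^{(n)}$ has a rational point of order $4$, and that every $p_i\equiv 1\pmod 8$. If $\mathrm{Sel}_2(E/\mathbb{Q})\cong(\mathbb{Z}/2\mathbb{Z})^2$, then every class of $\mathrm{Sel}_2'(E^{(n)})$ has a unique representative $(d_1,d_2,d_3)$ with each $d_i$ a positive divisor of $n$, and the map $(d_1,d_2,d_3)\mapsto\begin{pmatrix}\mathbf{x}\\ \mathbf{y}\end{pmatrix}$, where $\mathbf{x}=(v_{p_1}(d_1),\dots,v_{p_k}(d_1))^{\mathrm T}$ and $\mathbf{y}=(v_{p_1}(d_2),\dots,v_{p_k}(d_2))^{\mathrm T}$ in $\mathbb{F}_2^k$, induces an isomorphism of $\mathbb{F}_2$-vector spaces $$\mathrm{Sel}_2'(E^{(n)})\xrightarrow{\sim}\ker\begin{pmatrix}\mathbf{A}&\mathbf{O}\\ \mathbf{O}&\mathbf{A}\end{pmatrix}.$$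
   Context: For a nonzero integer $m$, $E^{(m)}$ is the elliptic curve $y^2=x(x-e_1m)(x+e_2m)$, $E=E^{(1)}$. For $\Lambda=(d_1,d_2,d_3)$ of nonzero square-free integers with $d_1d_2d_3$ a square, $D^{(m)}_\Lambda\subset\mathbb{P}^3$ (coordinates $(t,u_1,u_2,u_3)$) is defined by $e_1mt^2+d_2u_2^2-d_3u_3^2=0$, $e_2mt^2+d_3u_3^2-d_1u_1^2=0$, $e_3mt^2+d_1u_1^2-d_2u_2^2=0$. The 2-Selmer group $\mathrm{Sel}_2(E^{(m)}/\mathbb{Q})$ is identified with the group (under componentwise multiplication) of $\Lambda\in(\mathbb{Q}^\times/\mathbb{Q}^{\times2})^3$ with $d_1d_2d_3\in\mathbb{Q}^{\times2}$ and $D^{(m)}_\Lambda(\mathbb{A}_{\mathbb{Q}})\ne\emptyset$; the rational 2-torsion points of $E^{(m)}$ correspond to $(1,1,1)$, $(-e_3m,-e_1e_3,e_1m)$, $(-e_2e_3,e_3m,-e_2m)$, $(e_2m,-e_1m,-e_1e_2)$. The pure 2-Selmer group is $\mathrm{Sel}_2'(E^{(m)})=\mathrm{Sel}_2(E^{(m)}/\mathbb{Q})/(E^{(m)}(\mathbb{Q})_{\rm tors}/2E^{(m)}(\mathbb{Q})_{\rm tors})$ (when $E^{(m)}$ has no rational point of order $4$, this is the quotient by the subgroup of the four triples above). For a place $v$ and $\alpha,\beta\in\mathbb{Q}_v^\times$, $[\alpha,\beta]_v\in\mathbb{F}_2$ is the additive Hilbert symbol: $(\alpha,\beta)_v=(-1)^{[\alpha,\beta]_v}$.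 $\mathbf{A}=([p_j,-n]_{p_i})_{i,j}\in M_k(\mathbb{F}_2)$, $\mathbf{O}$ is the zero matrix. *)

(* Defs.v *)
From HB Require Import structures.
From mathcomp Require Import all_boot all_order all_algebra.
From mathcomp Require Import boolp Rstruct.

Set Implicit Arguments.
Unset Strict Implicit.
Unset Printing Implicit Defensive.
Import Order.TTheory GRing.Theory Num.Theory.
Local Open Scope ring_scope.

(* Systems of diagonal quadratic forms with integer coefficients.      *)
(* c : 'M[int]_(r, N) encodes the r forms  sum_i c j i * X_i^2  in N    *)
(* variables; the projective variety is their common zero locus in     *)
(* P^(N-1).                                                            *)

Definition diag_form (R : pzRingType) (N : nat) (c : 'I_N -> int)
  (x : 'I_N -> R) : R := \sum_(i < N) (c i)%:~R * x i ^+ 2.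

(* A Q_p-point of the projective variety is a primitive Z_p-point, and  *)
(* Z_p is the inverse limit of Z/p^k: a Z_p-point is a family of        *)
(* compatible integer sequences (a i k mod p^k), with some coordinate   *)
(* a unit, satisfying every equation modulo p^k for every k.            *)
Definition padic_solvable (p : nat) (r N : nat) (c : 'M[int]_(r, N)) : Prop :=
  exists a : 'I_N -> nat -> int,
    (forall i k, (a i k.+1 == a i k %[mod (p ^ k)%:Z])%Z) /\
    (exists i, ~~ ((p%:Z) %| a i 1%N)%Z) /\
    (forall j k, ((p ^ k)%:Z %| diag_form (fun i => c j i) (fun i => a i k))%Z).

Definition real_solvable (r N : nat) (c : 'M[int]_(r, N)) : Prop :=
  exists x : 'I_N -> Rdefinitions.R,
    (exists i, x i != 0) /\ (forall j, diag_form (fun i => c j i) x = 0).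

(* Points everywhere locally: X(A_Q) <> empty, X projective. *)
Definition adelic_solvable (r N : nat) (c : 'M[int]_(r, N)) : Prop :=
  real_solvable c /\ forall p, prime p -> padic_solvable p c.

(* The curve D^{(m)}_Lambda, variables (t, u1, u2, u3):                 *)
(*  e1 m t^2 + d2 u2^2 - d3 u3^2 = 0                                   *)
(*  e2 m t^2 + d3 u3^2 - d1 u1^2 = 0                                   *)
(*  e3 m t^2 + d1 u1^2 - d2 u2^2 = 0                                   *)
Definition D_coef (e1 e2 e3 m d1 d2 d3 : int) : 'M[int]_(3, 4) :=
  \matrix_(j < 3, i < 4)
    nth 0 (nth [::] [:: [:: e1 * m; 0; d2; - d3];
                        [:: e2 * m; - d1; 0; d3];
                        [:: e3 * m; d1; - d2; 0]] j) i.

Definition triple := (int * int * int)%type.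
Definition t1 (L : triple) : int := L.1.1.
Definition t2 (L : triple) : int := L.1.2.
Definition t3 (L : triple) : int := L.2.

(* integer squares; for nonzero integers a, b: a = b in Q^x/Q^x2 iff a*b is a square *)
Definition is_square (z : int) : Prop := exists w : int, z = w * w.

(* Lambda in Sel_2(E^{(m)}/Q), Lambda given by integer representatives *)
(* of classes in (Q^x/Q^x2)^3 (every class has such representatives).  *)
Definition inSel (e1 e2 e3 m : int) (L : triple) : Prop :=
  [/\ t1 L != 0, t2 L != 0, t3 L != 0,
      is_square (t1 L * t2 L * t3 L) &
      adelic_solvable (D_coef e1 e2 e3 m (t1 L) (t2 L) (t3 L))].

(* equality of triples in (Q^x/Q^x2)^3 *)
Definition sq_equiv (L L' : triple) : Prop :=
  [/\ is_square (t1 L * t1 L'), is_square (t2 L * t2 L') &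
      is_square (t3 L * t3 L')].

(* the images of the rational 2-torsion points of E^{(m)} *)
Definition torsion_triples (e1 e2 e3 m : int) : seq triple :=
  [:: (1, 1, 1);
      (- (e3 * m), - (e1 * e3), e1 * m);
      (- (e2 * e3), e3 * m, - (e2 * m));
      (e2 * m, - (e1 * m), - (e1 * e2))].

(* equality in Sel_2' = Sel_2 / (image of E^{(m)}(Q)[2]) (no 4-torsion) *)
Definition pure_equiv (e1 e2 e3 m : int) (L L' : triple) : Prop :=
  exists2 T, T \in torsion_triples e1 e2 e3 m &
    sq_equiv (t1 L * t1 T, t2 L * t2 T, t3 L * t3 T) L'.

Definition tmul (L L' : triple) : triple :=
  (t1 L * t1 L', t2 L * t2 L', t3 L * t3 L').

(* E^{(m)} : y^2 = x(x - e1 m)(x + e2 m) = x^3 + a2 x^2 + a4 x.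
   A rational point of order 4 is an affine point P = (x,y) with y <> 0
   (so 2P <> O) such that 2P has y-coordinate 0; by the doubling formula
   (tangent slope lam, third intersection point (x2, y + lam (x2 - x)),
   2P = (x2, -(y + lam (x2 - x)))). *)
Definition has_rat_point_of_order4 (e1 e2 m : int) : Prop :=
  let a2 : rat := ((e2 - e1) * m)%:~R in
  let a4 : rat := (- (e1 * e2 * m ^+ 2))%:~R in
  exists x y : rat,
    [/\ y ^+ 2 = x ^+ 3 + a2 * x ^+ 2 + a4 * x, y != 0 &
        let lam := (3 * x ^+ 2 + 2 * a2 * x + a4) / (2 * y) in
        let x2 := lam ^+ 2 - a2 - 2 * x in
        y + lam * (x2 - x) = 0].

(* additive Hilbert symbol [a,b]_p at a finite prime p:
   0 iff a X^2 + b Y^2 - Z^2 = 0 has a nontrivial Q_p-point. *)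
Definition hilbert_add (p : nat) (a b : int) : 'F_2 :=
  if asbool (padic_solvable p (\matrix_(j < 1, i < 3) nth 0 [:: a; b; -1] i))
  then 0 else 1.

Definition Amat (k : nat) (p : 'I_k -> nat) (n : nat) : 'M['F_2]_k :=
  \matrix_(i < k, j < k) hilbert_add (p i) (p j)%:Z (- n%:Z).

Definition val_vec (k : nat) (p : 'I_k -> nat) (L : triple) : 'cV['F_2]_(k + k) :=
  col_mx (\col_(i < k) ((logn (p i) `|t1 L|)%:R : 'F_2))
         (\col_(i < k) ((logn (p i) `|t2 L|)%:R : 'F_2)).

Definition pos_div (n : nat) (d : int) : Prop := (0 < d) /\ (`|d| %| n)%N.

Definition rep_triple (n : nat) (L : triple) : Prop :=
  [/\ pos_div n (t1 L), pos_div n (t2 L) & pos_div n (t3 L)].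

(* Main.v *)
Require Import Defs.
From HB Require Import structures.
From mathcomp Require Import all_boot all_order all_algebra all_field cyclic.
From mathcomp Require Import boolp Rstruct.
From mathcomp Require Import zify ring.
Import Order.TTheory GRing.Theory Num.Theory.
Local Open Scope ring_scope.

(* The primes [p_i] dividing [n] are squares in [R] and in [Q_q] for every
   [q] dividing [2 e1 e2 e3]. Hence multiplying the entries [d_i] of a Selmer
   element of the twist by the [n]-part [delta_i] of their square-free kernel
   gives a Selmer element of the untwisted curve: at the other primes a curve
   with unit coefficients always has a point, by a character sum. That element
   is torsion by hypothesis, so up to torsion the [d_i] are positive divisors
   of [n]; the representative is unique because the torsion triples are coprime
   to [n] and distinct modulo squares when there is no point of order 4.
   For positive divisors of [n] the only conditions are at the [p_i]. There,
   after translation by a torsion point to make the [d_i] units at [p_i], they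
   say that the [d_i] are squares modulo [p_i], since the [e_i] are squares by
   quadratic reciprocity. These are the rows of [A] applied to the valuation
   vectors. *)

(** * Quadratic characters and reciprocity *)

(** A point over Q_p is handled as a primitive integer solution modulo every power [p ^ K], with no
    compatibility between the levels. Changes of coordinates, such as translation by a torsion
    point, may destroy primitivity, but only by a power of [p] independent of [K]; dividing the
    common factor out costs a bounded amount of precision.

    The factors [delta_i] are needed because solvability on the twist forces even valuations of the
    [d_i] at primes of good reduction but not at the [p_i], where [d_i * delta_i] has even valuation
    by construction.

    A nontrivial torsion triple of E becomes one of the twist when two of its entries acquire a
    factor [n]. Modulo squares, multiplying a divisor by [n] gives the complementary divisor, so the
    representative still consists of positive divisors of [n].

    A diagonal entry of [A] is the class of [n / p_i] modulo [p_i]. The translation that makes the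
    [d_i] units at [p_i] replaces a factor [p_i] by the same [n / p_i]; this is why the local
    conditions are rows of [A]. *)

Definition sqb (F : finFieldType) (x : F) : bool := [exists y, y ^+ 2 == x].

Definition qchar (F : finFieldType) (x : F) : int :=
  if x == 0 then 0 else if sqb F x then 1 else -1.

Lemma sqbP (F : finFieldType) (x : F) : reflect (exists y, y ^+ 2 = x) (sqb F x).
Proof. by apply: (iffP existsP) => -[y /eqP]; exists y => //; apply/eqP. Qed.

Lemma finField_card_gt1 (F : finFieldType) : (1 < #|F|)%N.
Proof. exact: finNzRing_gt1. Qed.

Lemma finField_prim_root (F : finFieldType) :
  exists z : F, #|F|.-1.-primitive_root z.
Proof.
have q1 : (0 < #|F|.-1)%N by have := finField_card_gt1 F; lia.
have : has #|F|.-1.-primitive_root (enum (predC1 (0 : F))).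
  apply: has_prim_root => //; last 2 first.
  - exact: enum_uniq.
  - by rewrite -cardE cardC1.
  apply/allP => x; rewrite mem_enum inE => x0.
  apply/unity_rootP/(mulfI x0); rewrite -exprS mulr1 prednK ?expf_card //.
  by have := finField_card_gt1 F; lia.
by case/hasP => z _ ?; exists z.
Qed.

(** A nonsquare is an odd power of a generator of the unit group, so the product of two nonsquares
    is an even power. *)
Lemma sqb_mul (F : finFieldType) (x y : F) :
  x != 0 -> y != 0 -> sqb F (x * y) = (sqb F x == sqb F y).
Proof.
have sqM (a b : F) : a != 0 -> sqb F a -> sqb F (a * b) = sqb F b.
  move=> a0 /sqbP[c ca]; apply/sqbP/sqbP => -[d dE].
    exists (d / c); rewrite exprMn dE exprVn ca mulrAC divff ?mul1r //.
  by exists (c * d); rewrite exprMn ca dE.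
move=> x0 y0; case sx: (sqb F x); first by rewrite sqM //; case: (sqb F y).
case sy: (sqb F y); first by rewrite mulrC sqM.
have [z zP] := finField_prim_root F.
have powz (a : F) : a != 0 -> exists k, a = z ^+ k.
  move=> a0; have [|i ->] := prim_rootP zP (x := a); last by exists i.
  apply/(mulfI a0); rewrite -exprS mulr1 prednK ?expf_card //.
  by have := finField_card_gt1 F; lia.
have oddz k : ~~ sqb F (z ^+ k) -> odd k.
  apply: contraR => ek; apply/sqbP; exists (z ^+ k./2).
  by rewrite -exprM; congr (_ ^+ _); lia.
have [[i xE] [j yE]] := (powz x x0, powz y y0).
have oi : odd i by apply: oddz; rewrite -xE sx.
have oj : odd j by apply: oddz; rewrite -yE sy.
rewrite eqxx; apply/sqbP; exists (z ^+ ((i + j)./2)).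
by rewrite xE yE -exprD -exprM; congr (_ ^+ _); lia.
Qed.

Lemma qchar0 (F : finFieldType) : qchar F 0 = 0.
Proof. by rewrite /qchar eqxx. Qed.

Lemma qcharM (F : finFieldType) (x y : F) :
  qchar F (x * y) = qchar F x * qchar F y.
Proof.
rewrite /qchar mulf_eq0; case: (eqVneq x 0) => [->|x0]; first by rewrite /= mul0r.
case: (eqVneq y 0) => [->|y0] /=; first by rewrite mulr0.
by rewrite sqb_mul //; case: (sqb F x); case: (sqb F y).
Qed.

Lemma qchar_sqr (F : finFieldType) (x : F) : x != 0 -> qchar F (x ^+ 2) = 1.
Proof.
move=> x0; rewrite /qchar expf_eq0 /= (negPf x0).
by case: sqbP => // -[]; exists x.
Qed.

Lemma qchar1 (F : finFieldType) : qchar F 1 = 1.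
Proof. by rewrite -[X in qchar F X](expr1n _ 2) qchar_sqr ?oner_eq0. Qed.

Lemma qchar_ge (F : finFieldType) (x : F) : -1 <= qchar F x.
Proof. by rewrite /qchar; case: ifP => //; case: ifP. Qed.

Lemma qchar_neqN1 (F : finFieldType) (d c : F) :
  d != 0 -> qchar F (d * c) != -1 -> exists u, d * u ^+ 2 = c.
Proof.
move=> d0; rewrite /qchar mulf_eq0 (negPf d0) /=.
case: (eqVneq c 0) => [-> _|c0]; first by exists 0; rewrite expr0n mulr0.
case: sqbP => //= -[y yE] _; exists (y / d).
by rewrite exprMn yE; field.
Qed.

(** If every element were a square, squaring would be surjective on a finite set, hence injective,
    yet it identifies [1] and [-1]. *)
Lemma exists_nonsquare (F : finFieldType) :
  2%:R != 0 :> F -> exists r : F, qchar F r = -1.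
Proof.
move=> F2; have [/existsP[r]|/existsPn all_sq] := boolP [exists r, ~~ sqb F r].
  move=> rN; exists r; rewrite /qchar (negPf rN); case: eqP => // r0.
  by case/sqbP: rN; exists 0; rewrite r0 expr0n.
have sqI : injective (fun x : F => x ^+ 2).
  apply/injectiveP; rewrite /injectiveb /dinjectiveb.
  have -> : map (fun x : F => x ^+ 2) (enum F) = codom (fun x : F => x ^+ 2) by [].
  apply/card_uniqP; rewrite size_codom; apply: eq_card => x.
  rewrite !inE; apply/codomP.
  by have := all_sq x; rewrite negbK => /sqbP[y <-]; exists y.
have /eqP := sqI 1 (-1) (etrans (expr1n _ _) (esym (sqrr_sign _ 1))).
by rewrite -subr_eq0 opprK (negPf F2).
Qed.

Lemma sum_qchar (F : finFieldType) : 2%:R != 0 :> F -> \sum_x qchar F x = 0.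
Proof.
move=> F2; have [r rE] := exists_nonsquare F F2.
have r0 : r != 0 by apply: contra_eq_neq rE => ->; rewrite qchar0.
have : \sum_x qchar F x = - \sum_x qchar F x.
  rewrite {1}(reindex_inj (mulfI r0)) -sumrN; apply: eq_bigr => x _.
  by rewrite qcharM rE mulN1r.
by move: (\sum_x _) => S; lia.
Qed.

Lemma sum_qchar_shift (F : finFieldType) (d a : F) :
  2%:R != 0 :> F -> \sum_x qchar F (d * (x + a)) = 0.
Proof.
move=> F2; transitivity (qchar F d * \sum_x qchar F x); last by rewrite sum_qchar ?mulr0.
rewrite mulr_sumr (reindex_inj (addIr (- a))) /=; apply: eq_bigr => x _.
by rewrite subrK qcharM.
Qed.

(** After a shift, [x * (x + c) = x ^+ 2 * (1 + c / x)] for nonzero [x], and [1 + c / x] takes every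
    value except [1]; the total is minus the character of [1]. *)
Lemma sum_qchar_quadratic (F : finFieldType) (a b : F) :
  2%:R != 0 :> F -> a != b -> \sum_x qchar F ((x + a) * (x + b)) = -1.
Proof.
move=> F2 ab; set c := b - a; have c0 : c != 0 by rewrite subr_eq0 eq_sym.
rewrite (reindex_inj (addIr (- a))) /=.
(* The convention [0^-1 = 0] gives [h 0 = 1], the missing value, so [h] permutes the whole field. *)
pose h x : F := 1 + c * x^-1.
have hI : injective h by move=> x y /addrI /(mulfI c0) /invr_inj.
rewrite (bigD1 0) //= subrK mul0r qchar0 add0r.
transitivity (\sum_(x | x != 0) qchar F (h x)).
  apply: eq_bigr => x x0; rewrite subrK -addrA [- a + b]addrC -/c.
  have -> : x * (x + c) = x ^+ 2 * h x by rewrite /h; field.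
  by rewrite qcharM qchar_sqr ?mul1r.
have := sum_qchar F F2; rewrite (reindex_inj hI) (bigD1 0) //=.
by rewrite {1}/h invr0 mulr0 addr0 qchar1; move: (\sum_(_ | _) _) => S; lia.
Qed.

(* Summing the product of the three factors [1 + qchar (d_i ...)] over [x]
   gives [q - \sum_i qchar d_i + S], where the cubic sum [S] does not depend
   on the [d_i] and [q + S > 0] because it counts points of the elliptic curve. *)
Lemma curve_point (F : finFieldType) (d1 d2 d3 a b : F) :
  2%:R != 0 :> F -> d1 != 0 -> d2 != 0 -> d3 != 0 ->
  a != 0 -> b != 0 -> a != b ->
  qchar F (d1 * d2 * d3) = 1 ->
  exists t u1 u2 u3 : F,
    [/\ d2 * u2 ^+ 2 = d1 * u1 ^+ 2 + a * t ^+ 2,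
        d3 * u3 ^+ 2 = d1 * u1 ^+ 2 + b * t ^+ 2 &
        ~~ [&& t == 0, u1 == 0, u2 == 0 & u3 == 0]].
Proof.
move=> F2 d10 d20 d30 a0 b0 ab dE.
have E3 : qchar F d1 * qchar F d2 * qchar F d3 = 1 by rewrite -!qcharM.
have qv (d : F) : d != 0 -> qchar F d = 1 \/ qchar F d = -1.
  by move=> d0; rewrite /qchar (negPf d0); case: ifP; [left|right].
have sol1 (d : F) : d != 0 -> qchar F d = 1 -> exists u, d * u ^+ 2 = 1.
  by move=> d0 E; apply: qchar_neqN1; rewrite ?mulr1 ?E.
(* The characters of the [d_i] multiply to 1, so all three are 1 or exactly one is. In the first
   case positivity of [q + S] alone does not suffice, but there is a point with [t = 0]. *)
have [[E1 E2]|NE] : (qchar F d1 = 1 /\ qchar F d2 = 1) \/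
    qchar F d1 + qchar F d2 + qchar F d3 = -1.
- by move: E3; case: (qv _ d10) => ->; case: (qv _ d20) => ->;
    case: (qv _ d30) => -> //; auto.
- have E3' : qchar F d3 = 1 by move: E3; rewrite E1 E2 !mul1r.
  have [[u1 U1] [u2 U2] [u3 U3]] := And3 (sol1 _ d10 E1) (sol1 _ d20 E2) (sol1 _ d30 E3').
  exists 0, u1, u2, u3; rewrite U1 U2 U3 expr0n /= !mulr0 addr0; split => //.
  rewrite eqxx /=; apply/negP => /andP[/eqP u10 _].
  by move/eqP: U1; rewrite u10 expr0n mulr0 eq_sym oner_eq0.
(* Here [x] stands for [d1 * u1 ^+ 2] at [t = 1]: a nonzero [P x] means that no factor has character
   [-1], so [u1], [u2] and [u3] all exist. *)
pose P x : int := (1 + qchar F (d1 * (x + 0))) * (1 + qchar F (d2 * (x + a))) *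
  (1 + qchar F (d3 * (x + b))).
suff /eqP : \sum_x P x != 0.
  have [/existsP[x Px] _|/existsPn noP []] := boolP [exists x, P x != 0]; last first.
    by apply: big1 => x _; apply/eqP; rewrite -[_ == _]negbK; apply: noP.
  move: Px; rewrite /P !mulf_eq0 !negb_or => /andP[/andP[P1 P2] P3].
  have nz (y : F) : 1 + qchar F y != 0 -> qchar F y != -1.
    by apply: contraNneq => ->.
  have [u1 U1] := qchar_neqN1 F _ _ d10 (nz _ P1).
  have [u2 U2] := qchar_neqN1 F _ _ d20 (nz _ P2).
  have [u3 U3] := qchar_neqN1 F _ _ d30 (nz _ P3).
  exists 1, u1, u2, u3; rewrite U1 U2 U3 oner_eq0 expr1n; split=> //.
    by rewrite !mulr1 addr0.
  by rewrite !mulr1 addr0.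
pose S := \sum_x qchar F ((x + 0) * (x + a) * (x + b)).
have qS : 0 < #|F|%:Z + S.
  have -> : #|F|%:Z + S = \sum_x (1 + qchar F ((x + 0) * (x + a) * (x + b))).
    by rewrite big_split /= sumr_const -[1 *+ _]/(#|F|%:R) natz.
  rewrite (bigD1 0) //= addr0 !mul0r qchar0 addr0.
  apply: ltr_wpDr => //; apply: sumr_ge0 => x _.
  by rewrite -lerBlDl sub0r qchar_ge.
have -> : \sum_x P x = #|F|%:Z + S - (qchar F d1 + qchar F d2 + qchar F d3).
  have -> : \sum_x P x = \sum_x ((1 + qchar F (d1 * (x + 0)) + qchar F (d2 * (x + a)) +
      qchar F (d3 * (x + b)) + qchar F d3 * qchar F ((x + 0) * (x + a)) +
      qchar F d2 * qchar F ((x + 0) * (x + b)) +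
      qchar F d1 * qchar F ((x + a) * (x + b)) +
      qchar F ((x + 0) * (x + a) * (x + b)))).
    apply: eq_bigr => x _; rewrite /P !qcharM.
    move: E3; move: (qchar F (x + 0)) (qchar F (x + a)) (qchar F (x + b)) => A B C.
    by case: (qv _ d10) => ->; case: (qv _ d20) => ->; case: (qv _ d30) => -> // _; ring.
  rewrite !big_split /= -!mulr_sumr !sum_qchar_shift // !sum_qchar_quadratic // 1?eq_sym //.
  by rewrite sumr_const -[1 *+ _]/(#|F|%:R) natz /S; ring.
by rewrite NE; apply: lt0r_neq0; lia.
Qed.

(** For a primitive eighth root of unity [w], [-1 = (w ^+ 2) ^+ 2] and [2 = (w + w^-1) ^+ 2], where
    [w^-1 = - w ^+ 3]. *)
Lemma sqb_N1_2 (F : finFieldType) :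
  2%:R != 0 :> F -> (8 %| #|F|.-1)%N -> sqb F (-1) /\ sqb F 2%:R.
Proof.
move=> F2 /dvdnP[m mE]; have [z zP] := finField_prim_root F.
pose w := z ^+ m.
have w4 : w ^+ 4 = -1.
  have : (w ^+ 4 - 1) * (w ^+ 4 + 1) = 0.
    rewrite -subr_sqr expr1n -!exprM (_ : (m * (4 * 2))%N = #|F|.-1); last by lia.
    by rewrite (prim_expr_order zP) subrr.
  move/eqP; rewrite mulf_eq0 => /orP[|]; last by rewrite addr_eq0 => /eqP.
  rewrite subr_eq0 -exprM -(prim_order_dvd zP) mE => /dvdn_leq.
  by have := prim_order_gt0 zP; lia.
split; apply/sqbP; first by exists (w ^+ 2); rewrite -exprM.
exists (w - w ^+ 3).
have -> : (w - w ^+ 3) ^+ 2 = w ^+ 2 - 2%:R * w ^+ 4 + w ^+ 2 * w ^+ 4 by ring.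
by rewrite w4; ring.
Qed.

Lemma card_Fp_pred (p : nat) : prime p -> #|'F_p|.-1 = p.-1.
Proof. by move=> pp; rewrite card_Fp. Qed.

Lemma natr_Fp_eq0 (p m : nat) : prime p -> (m%:R == 0 :> 'F_p) = (p %| m)%N.
Proof. by move=> pp; rewrite (dvdn_pcharf (pchar_Fp pp)). Qed.

(* The Gauss sum [G] of ['F_p] in characteristic [q] satisfies [G ^+ 2 = p]
   and [G ^+ q = qchar q * G]; if [p] is a square modulo [q] then [G] lies in
   the prime field. *)
Lemma quadratic_reciprocity_1mod4 (p q x : nat) :
  prime p -> prime q -> odd q -> p != q -> sqb 'F_p (-1) -> odd p ->
  (x ^ 2 == p %[mod q])%N -> sqb 'F_p q%:R.
Proof.
move=> pp qp qodd pq sN1 podd xE.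
have p1 := prime_gt1 pp.
have F2 : 2%:R != 0 :> 'F_p.
  by rewrite natr_Fp_eq0 //; apply/negP => /(dvdn_leq (isT : (0 < 2)%N)); rewrite leqNgt odd_prime_gt2.
(* By Fermat [p] divides [q ^ p.-1 - 1], so the extension of degree [p.-1] of the field with [q]
   elements contains the [p]-th roots of unity. *)
have [L Lq Lcard] := @pPrimePowerField q p.-1 qp (ltac:(lia)).
have [z zP] := finField_prim_root L.
have pdv : (p %| #|L|.-1)%N.
  have cop : coprime q p by rewrite prime_coprime // dvdn_prime2 // eq_sym.
  rewrite Lcard -(totient_prime pp) -subn1 -eqn_mod_dvd; last by rewrite expn_gt0 prime_gt0.
  by apply/eqP/Euler_exp_totient.
have zeP := dvdn_prim_root zP pdv; set ze := z ^+ _ in zeP.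
pose e (a : 'F_p) : L := ze ^+ a.
have eD a b : e (a + b) = e a * e b.
  rewrite /e -exprD /= -[LHS](prim_expr_mod zeP) -[RHS](prim_expr_mod zeP).
  by rewrite modn_dvdm // Fp_cast.
have e0 : e 0 = 1 by rewrite /e expr0.
have eX (a : 'F_p) m : e (m%:R * a) = e a ^+ m.
  elim: m => [|m IH]; first by rewrite mul0r e0 expr0.
  by rewrite -natr1 mulrDl mul1r eD IH exprSr.
have se : \sum_a e a = 0.
  have e1 : e 1 != 1.
    have E1 : nat_of_ord (1 : 'F_p) = 1%N by rewrite /= modn_small.
    by rewrite /e E1 -(prim_order_dvd zeP) dvdn1; lia.
  have E : e 1 * \sum_a e a = \sum_a e a.
    rewrite [RHS](reindex_inj (addrI 1)) mulr_sumr /=.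
    by apply: eq_bigr => a _; rewrite eD.
  apply/eqP; have /eqP : (e 1 - 1) * \sum_a e a = 0 by rewrite mulrBl E mul1r subrr.
  by rewrite mulf_eq0 subr_eq0 (negPf e1).
have sec c : \sum_(a | a != 0) e (a * (1 + c)) = (if c == -1 then p%:R else 0) - 1.
  have -> : \sum_(a | a != 0) e (a * (1 + c)) = \sum_a e (a * (1 + c)) - 1.
    by rewrite [X in _ = X - 1](bigD1 0) //= mul0r e0 addrC addrK.
  congr (_ - _); case: eqP => [->|/eqP c1].
    under eq_bigr do rewrite subrr mulr0 e0.
    by rewrite sumr_const card_Fp.
  have c0 : 1 + c != 0 by rewrite addrC addr_eq0.
  by apply: etrans se; rewrite [RHS](reindex_inj (mulIf c0)).
pose chi (a : 'F_p) : L := (qchar _ a)%:~R.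
have chiM a b : chi (a * b) = chi a * chi b by rewrite /chi qcharM intrM.
have schi : \sum_a chi a = 0 by rewrite /chi -rmorph_sum /= sum_qchar.
pose G := \sum_a chi a * e a.
have G2 : G ^+ 2 = p%:R.
  (* Writing the second index as [a * c] removes the character of [a]. The sum over [a] is then
     [p - 1] for [c = -1] and [-1] otherwise; the constant [-1] is killed by [schi], and no sign
     remains because [-1] is a square. *)
  have -> : G ^+ 2 = \sum_(a | a != 0) \sum_c chi c * e (a * (1 + c)).
    rewrite expr2 {1}/G (bigD1 0) //= {1}/chi qchar0 mul0r add0r mulr_suml.
    apply: eq_bigr => a a0; rewrite /G mulr_sumr (reindex_inj (mulfI a0)) /=.
    apply: eq_bigr => c _; rewrite mulrDr mulr1 eD chiM.
    have : chi a * chi a = 1 by rewrite -chiM /chi -expr2 qchar_sqr.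
    move=> E; rewrite -[RHS]mul1r -E; ring.
  rewrite exchange_big /=.
  under eq_bigr do rewrite -mulr_sumr sec mulrBr mulr1.
  rewrite sumrB schi subr0 (bigD1 (-1)) //= eqxx big1 ?addr0.
    by rewrite /chi /qchar sN1 oppr_eq0 oner_eq0 mul1r.
  by move=> c /negPf ->; rewrite mulr0.
have q0 : q%:R != 0 :> 'F_p by rewrite natr_Fp_eq0 // dvdn_prime2.
have Gq : G ^+ q = chi q%:R * G.
  rewrite -(pFrobenius_autE Lq) /G rmorph_sum /= mulr_sumr [RHS](reindex_inj (mulfI q0)).
  apply: eq_bigr => a _; rewrite rmorphM /= rmorph_int pFrobenius_autE eX chiM.
  rewrite mulrA mulrA; congr (_ * _).
  by rewrite -chiM -expr2 /chi qchar_sqr // mul1r.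
have pL : p%:R != 0 :> L by rewrite -(dvdn_pcharf Lq) dvdn_prime2 // eq_sym.
have xL : x%:R ^+ 2 = p%:R :> L.
  rewrite -natrX; apply/eqP.
  have ext m : m%:R = (m %% q)%:R :> L.
    by rewrite {1}(divn_eq m q) natrD natrM (pcharf0 Lq) mulr0 add0r.
  by rewrite ext (eqP xE) -ext.
have GG : G ^+ q = G.
  have /eqP := etrans G2 (esym xL); rewrite eqf_sqr -(pFrobenius_autE Lq).
  by case/orP => /eqP ->; rewrite ?rmorphN rmorph_nat.
have G0 : G != 0 by apply: contraNneq pL => G0; rewrite -G2 G0 expr0n.
have chi1 : chi q%:R = 1 by apply: (mulIf G0); rewrite -Gq GG mul1r.
move: chi1; rewrite /chi /qchar (negPf q0); case: ifP => // _ /eqP.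
rewrite eq_sym -subr_eq0 opprK -(natrD _ 1 1) -(dvdn_pcharf Lq) => /(dvdn_leq (isT : (0 < 2)%N)).
by rewrite leqNgt odd_prime_gt2.
Qed.

(** Reciprocity turns the hypothesis around at each odd prime factor of [e]; the sign of [e] and its
    powers of 2 are squares because [p] is 1 modulo 8. *)
Lemma int_residue_square (p : nat) (e : int) :
  prime p -> (p %% 8 = 1)%N -> e != 0 ->
  ~~ (p %| `|e|)%N ->
  (forall q, prime q -> odd q -> (q %| `|e|)%N -> exists x : nat, (x ^ 2 == p %[mod q])%N) ->
  sqb 'F_p e%:~R.
Proof.
move=> pp p8 e0 pe eq_res.
have podd : odd p by lia.
have p1 := prime_gt1 pp.
have F2 : 2%:R != 0 :> 'F_p.
  by rewrite natr_Fp_eq0 //; apply/negP => /(dvdn_leq (isT : (0 < 2)%N)); rewrite leqNgt odd_prime_gt2.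
have [sN1 s2] : sqb 'F_p (-1) /\ sqb 'F_p 2%:R.
  by apply: sqb_N1_2 => //; rewrite card_Fp_pred //; lia.
have sM (a b : 'F_p) : sqb 'F_p a -> sqb 'F_p b -> sqb 'F_p (a * b).
  by move=> /sqbP[u <-] /sqbP[v <-]; apply/sqbP; exists (u * v); rewrite exprMn.
suff : sqb 'F_p `|e|%N%:R.
  move=> se; rewrite [e]intEsign rmorphM /= rmorphXn /= rmorphN1 -pmulrn.
  by apply: sM => //; case: (e < 0); rewrite ?expr0 ?expr1 //; apply/sqbP; exists 1; rewrite expr1n.
move: pe eq_res; have : (0 < `|e|)%N by rewrite absz_gt0.
move: `|e|%N => {e e0} m m0 pm qm.
rewrite (prod_prime_decomp m0) prime_decompE big_map natr_prod.
have primes_sq q : q \in primes m -> sqb 'F_p (q ^ logn q m)%:R.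
  rewrite mem_primes => /and3P[qp _ qdm]; rewrite natrX.
  have sq : sqb 'F_p q%:R.
    have [q2|qodd] := even_prime qp; first by rewrite q2.
    have [x xE] := qm q qp qodd qdm.
    apply: quadratic_reciprocity_1mod4 xE => //.
    by apply: contraNneq pm => ->.
  by case/sqbP: sq => y <-; apply/sqbP; exists (y ^+ logn q m); rewrite exprAC.
rewrite big_seq; elim/big_ind: _ => //=; by apply/sqbP; exists 1; rewrite expr1n.
Qed.

(** * Local solvability *)

Definition modsol (p r N : nat) (c : 'M[int]_(r, N)) (K : nat) (x : 'I_N -> int) : Prop :=
  (exists i, ~~ (p%:Z %| x i)%Z) /\
  (forall j, ((p ^ K)%:Z %| diag_form (fun i => c j i) x)%Z).

Definition congr_at (p N k : nat) (x y : 'I_N -> int) : Prop :=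
  forall i, ((p ^ k)%:Z %| x i - y i)%Z.

Lemma diag_form_congr (p N k : nat) (c x y : 'I_N -> int) :
  congr_at p N k x y ->
  ((p ^ k)%:Z %| diag_form c x)%Z = ((p ^ k)%:Z %| diag_form c y)%Z.
Proof.
move=> xy; have D : ((p ^ k)%:Z %| diag_form c x - diag_form c y)%Z.
  rewrite /diag_form -sumrB; apply: rpred_sum => i _.
  by rewrite -mulrBr subr_sqr mulrCA dvdz_mulr // xy.
by rewrite -[diag_form c x](subrK (diag_form c y)) rpredDl.
Qed.

Lemma dvdz_expn_le (p k l : nat) (z : int) :
  (k <= l)%N -> ((p ^ l)%:Z %| z)%Z -> ((p ^ k)%:Z %| z)%Z.
Proof. by move=> kl; apply: dvdz_trans; exact: (dvdn_exp2l p kl). Qed.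

Lemma modsol_le (p r N : nat) (c : 'M[int]_(r, N)) (K K' : nat) (x : 'I_N -> int) :
  (K <= K')%N -> modsol p r N c K' x -> modsol p r N c K x.
Proof. by move=> KK [px fx]; split=> // j; apply: dvdz_expn_le KK (fx j). Qed.

(* Koenig's lemma: only finitely many residues modulo each power of [p]. *)
Lemma padic_solvableP (p r N : nat) (c : 'M[int]_(r, N)) : prime p ->
  padic_solvable p c <-> forall K, exists x, modsol p r N c K x.
Proof.
move=> pp; split=> [[a [ca [[i0 pa] fa]]] K|sol].
  (* The index is [K.+1] because the sequences are determined modulo [p] only from index 1 on, which
     matters when [K = 0]. *)
  exists (a ^~ K.+1); split; last by move=> j; apply: dvdz_expn_le (fa j K.+1).
  exists i0; have : (p%:Z %| a i0 K.+1 - a i0 1%N)%Z.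
    elim: K => [|K IH]; first by rewrite subrr dvdz0.
    rewrite -[a i0 K.+2](subrK (a i0 K.+1)) -addrA rpredDr //.
    have := ca i0 K.+1; rewrite eqz_mod_dvd => /(dvdz_expn_le p 1 K.+1).
    by rewrite expn1; apply.
  by move=> d; rewrite -[a i0 K.+1](subrK (a i0 1%N)) rpredDl.
(* These are the nodes of the tree of residues that have primitive solutions of every precision
   above them. *)
pose good k (x : 'I_N -> int) :=
  forall K, exists2 y, congr_at p N k x y & modsol p r N c K y.
have step (kx : nat * ('I_N -> int)) : exists x', good kx.1 kx.2 ->
    congr_at p N kx.1 kx.2 x' /\ good kx.1.+1 x'.
  case: kx => k x /=.
  have [gx|ngx] := pselect (good k x); last by exists x.
  (* If no child were good, each of the finitely many residues modulo [p ^ k.+1] above [x] would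
     stop at some level [Kf h]; a solution at the largest of these levels contradicts this. *)
  apply: contrapT => none.
  pose X (h : {ffun 'I_N -> 'I_(p ^ k.+1)}) : 'I_N -> int := fun i => (h i : nat)%:Z.
  have /choice[Kf KfP] : forall h, exists K, congr_at p N k x (X h) ->
      forall y, congr_at p N k.+1 (X h) y -> ~ modsol p r N c K y.
    move=> h; apply: contrapT => noK; apply: none; exists (X h) => _.
    have cx : congr_at p N k x (X h).
      by apply: contrapT => ncx; apply: noK; exists 0%N.
    split=> // K; apply: contrapT => noy; apply: noK; exists K => _ y cy my.
    by apply: noy; exists y.
  have [y cy my] := gx (\max_h Kf h)%N.
  have lt i : (`|(y i %% (p ^ k.+1)%:Z)%Z| < p ^ k.+1)%N.
    by rewrite -ltz_nat gez0_abs ?modz_ge0 ?ltz_mod // ?ltz_pmod -?lt0n ?expn_gt0 ?prime_gt0.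
  pose h : {ffun 'I_N -> 'I_(p ^ k.+1)} := [ffun i => Ordinal (lt i)].
  have hy : congr_at p N k.+1 (X h) y.
    have P0 : (p ^ k.+1)%:Z != 0 by rewrite eqz_nat -lt0n expn_gt0 prime_gt0.
    by move=> i; rewrite /X ffunE /= gez0_abs ?modz_ge0 // -eqz_mod_dvd modz_mod.
  apply: (KfP h _ y hy); last by apply: modsol_le my; apply: leq_bigmax.
  move=> i; have -> : x i - X h i = (x i - y i) - (X h i - y i) by ring.
  by apply: rpredB; [apply: cy | apply: dvdz_expn_le (hy i)].
have /choice[f fP] := step.
pose a := fix a k : 'I_N -> int := if k is k'.+1 then f (k', a k') else fun=> 0.
have ga k : good k (a k).
  elim: k => [K|k IH]; last by have [] := fP (k, a k) IH.
  by have [y my] := sol K; exists y => // i; rewrite expn0 dvd1z.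
exists (fun i k => a k i); split; [|split].
- move=> i k; have [ck _] := fP (k, a k) (ga k).
  by rewrite eqz_mod_dvd -opprB rpredN; apply: ck.
- have [y cy [[i yi] _]] := ga 1%N 0%N; exists i.
  apply: contra yi => ai; have := cy i; rewrite expn1 => cyi.
  by rewrite -[y i](subKr (a 1%N i)) rpredB.
- by move=> j k; have [y cy [_ fy]] := ga k k; rewrite (diag_form_congr _ _ _ _ _ _ cy).
Qed.

Definition dsol (M f1 f2 f3 d1 d2 d3 t u1 u2 u3 : int) : Prop :=
  [/\ (M %| f1 * t ^+ 2 + d2 * u2 ^+ 2 - d3 * u3 ^+ 2)%Z,
      (M %| f2 * t ^+ 2 + d3 * u3 ^+ 2 - d1 * u1 ^+ 2)%Z &
      (M %| f3 * t ^+ 2 + d1 * u1 ^+ 2 - d2 * u2 ^+ 2)%Z].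

Definition alldvd (M t u1 u2 u3 : int) : bool :=
  [&& (M %| t)%Z, (M %| u1)%Z, (M %| u2)%Z & (M %| u3)%Z].

(* By Koenig's lemma this is solvability over [Q_p] of the curve with
   [f_i = e_i m]. *)
Definition lsol (p : nat) (f1 f2 f3 d1 d2 d3 : int) : Prop :=
  forall K, exists t u1 u2 u3 : int,
    dsol (p ^ K)%:Z f1 f2 f3 d1 d2 d3 t u1 u2 u3 /\ ~~ alldvd p%:Z t u1 u2 u3.

Lemma padic_lsol (p : nat) (e1 e2 e3 m d1 d2 d3 : int) : prime p ->
  padic_solvable p (D_coef e1 e2 e3 m d1 d2 d3) <->
  lsol p (e1 * m) (e2 * m) (e3 * m) d1 d2 d3.
Proof.
move=> pp; rewrite padic_solvableP //.
pose i1 : 'I_4 := lift ord0 ord0.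
pose i2 : 'I_4 := lift ord0 (lift ord0 ord0).
pose i3 : 'I_4 := lift ord0 (lift ord0 (lift ord0 ord0)).
have formE (x : 'I_4 -> int) (j : 'I_3) :
  diag_form (fun i => D_coef e1 e2 e3 m d1 d2 d3 j i) x =
  nth 0 [:: e1 * m * x ord0 ^+ 2 + d2 * x i2 ^+ 2 - d3 * x i3 ^+ 2;
            e2 * m * x ord0 ^+ 2 + d3 * x i3 ^+ 2 - d1 * x i1 ^+ 2;
            e3 * m * x ord0 ^+ 2 + d1 * x i1 ^+ 2 - d2 * x i2 ^+ 2] j.
  rewrite /diag_form !big_ord_recl big_ord0 !mxE /= -/i1 -/i2 -/i3 !intz.
  case: j => [[|[|[|//]]]] /= _; ring.
split=> sol K; have := sol K.
  case=> x [[i px] fx]; exists (x ord0), (x i1), (x i2), (x i3); split.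
    split; [have := fx ord0 | have := fx (lift ord0 ord0) |
      have := fx (lift ord0 (lift ord0 ord0))]; by rewrite formE.
  apply: contra px => /and4P[p0 p1 p2 p3].
  case: i => [[|[|[|[|//]]]] lt]; [move: p0|move: p1|move: p2|move: p3];
    by congr (is_true (_ %| x _)%Z); apply: val_inj.
case=> t [u1 [u2 [u3 [[E1 E2 E3] prim]]]].
exists (fun i : 'I_4 => nth 0 [:: t; u1; u2; u3] i); split.
  move: prim; rewrite /alldvd !negb_and => /or4P[] P;
    [exists ord0|exists i1|exists i2|exists i3] => //.
by move=> j; rewrite formE; case: j => [[|[|[|//]]]].
Qed.

Lemma dvdz_eqr (M a b : int) : a = b -> (M %| a)%Z -> (M %| b)%Z.
Proof. by move=> ->. Qed.

Lemma dvdzD (M a b : int) : (M %| a)%Z -> (M %| b)%Z -> (M %| a + b)%Z.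
Proof. exact: rpredD. Qed.

Lemma dvdzN (M a : int) : (M %| a)%Z -> (M %| - a)%Z.
Proof. by rewrite rpredN. Qed.

Lemma dvdzB (M a b : int) : (M %| a)%Z -> (M %| b)%Z -> (M %| a - b)%Z.
Proof. exact: rpredB. Qed.

Lemma dsol_of_two (M f1 f2 f3 d1 d2 d3 t u1 u2 u3 : int) : f1 + f2 + f3 = 0 ->
  (M %| f2 * t ^+ 2 + d3 * u3 ^+ 2 - d1 * u1 ^+ 2)%Z ->
  (M %| f3 * t ^+ 2 + d1 * u1 ^+ 2 - d2 * u2 ^+ 2)%Z ->
  dsol M f1 f2 f3 d1 d2 d3 t u1 u2 u3.
Proof.
move=> f0 E2 E3; split=> //.
have -> : f1 = - f2 - f3 by apply/eqP; rewrite -subr_eq0 -f0; apply/eqP; ring.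
have := dvdzD _ _ _ (dvdzN _ _ E2) (dvdzN _ _ E3); apply: dvdz_eqr; ring.
Qed.

Lemma coprime_expz (p k : nat) (z : int) :
  prime p -> ~~ (p%:Z %| z)%Z -> coprimez (p ^ k)%:Z z.
Proof.
move=> pp pz; rewrite /coprimez /gcdz eqz_nat; apply: coprimeXl.
by rewrite prime_coprime.
Qed.

Lemma primez_dvdM (p : nat) (a b : int) :
  prime p -> (p%:Z %| a * b)%Z = (p%:Z %| a)%Z || (p%:Z %| b)%Z.
Proof. by move=> pp; rewrite !dvdzE abszM Euclid_dvdM. Qed.

Lemma primez_dvdX2 (p : nat) (a : int) :
  prime p -> (p%:Z %| a ^+ 2)%Z = (p%:Z %| a)%Z.
Proof. by move=> pp; rewrite expr2 primez_dvdM // orbb. Qed.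

(** Dividing all coordinates by [p] costs a factor [p ^ 2] in the modulus, since the equations are
    quadratic. It can happen fewer than [v] times. *)
Lemma dsol_descend (p v K : nat) (f1 f2 f3 d1 d2 d3 t u1 u2 u3 : int) :
  prime p ->
  dsol (p ^ (K + 2 * v))%:Z f1 f2 f3 d1 d2 d3 t u1 u2 u3 ->
  ~~ alldvd (p ^ v)%:Z t u1 u2 u3 ->
  exists t' u1' u2' u3' : int,
    dsol (p ^ K)%:Z f1 f2 f3 d1 d2 d3 t' u1' u2' u3' /\ ~~ alldvd p%:Z t' u1' u2' u3'.
Proof.
move=> pp; elim: v t u1 u2 u3 => [|v IH] t u1 u2 u3.
  by rewrite /alldvd expn0 !dvd1z.
move=> [E1 E2 E3] nd; have [/and4P[]|prim] := boolP (alldvd p%:Z t u1 u2 u3); last first.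
  exists t, u1, u2, u3; split=> //.
  by split; [move: E1|move: E2|move: E3]; apply: dvdz_expn_le; rewrite leq_addr.
move=> /dvdzP[t' tE] /dvdzP[u1' u1E] /dvdzP[u2' u2E] /dvdzP[u3' u3E].
apply: (IH t' u1' u2' u3').
  have dv (a b c x y z : int) : ((p ^ (K + 2 * v.+1))%:Z %|
      a * (x * p%:Z) ^+ 2 + b * (y * p%:Z) ^+ 2 - c * (z * p%:Z) ^+ 2)%Z ->
      ((p ^ (K + 2 * v))%:Z %| a * x ^+ 2 + b * y ^+ 2 - c * z ^+ 2)%Z.
    have -> : a * (x * p%:Z) ^+ 2 + b * (y * p%:Z) ^+ 2 - c * (z * p%:Z) ^+ 2 =
      (a * x ^+ 2 + b * y ^+ 2 - c * z ^+ 2) * p%:Z ^+ 2 by ring.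
    have -> : (p ^ (K + 2 * v.+1))%:Z = (p ^ (K + 2 * v))%:Z * p%:Z ^+ 2.
      by rewrite mulnS addnCA addnC expnD PoszM -[(p ^ 2)%:Z]/((p * p)%:Z) PoszM.
    by rewrite dvdz_mul2r // expf_neq0 // eqz_nat -lt0n prime_gt0.
  by subst; split; apply: dv.
apply: contra nd; rewrite /alldvd tE u1E u2E u3E !expnSr PoszM.
by rewrite !dvdz_mul2r // eqz_nat -lt0n prime_gt0.
Qed.

(** Primitivity may be weakened to a bound on the common power of [p] that does not depend on [K];
    coordinates can thus be multiplied by fixed nonzero integers. *)
Lemma lsol_bounded (p v : nat) (f1 f2 f3 d1 d2 d3 : int) : prime p ->
  (forall K, exists t u1 u2 u3 : int,
    dsol (p ^ K)%:Z f1 f2 f3 d1 d2 d3 t u1 u2 u3 /\ ~~ alldvd (p ^ v)%:Z t u1 u2 u3) ->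
  lsol p f1 f2 f3 d1 d2 d3.
Proof.
move=> pp sol K; have [t [u1 [u2 [u3 [S nd]]]]] := sol (K + 2 * v)%N.
exact: dsol_descend S nd.
Qed.

Lemma alldvd_scale (p v : nat) (a0 a1 a2 a3 t u1 u2 u3 : int) : prime p ->
  ~~ ((p ^ v)%:Z %| a0)%Z -> ~~ ((p ^ v)%:Z %| a1)%Z ->
  ~~ ((p ^ v)%:Z %| a2)%Z -> ~~ ((p ^ v)%:Z %| a3)%Z ->
  ~~ alldvd p%:Z t u1 u2 u3 ->
  ~~ alldvd (p ^ v)%:Z (a0 * t) (a1 * u1) (a2 * u2) (a3 * u3).
Proof.
move=> pp A0 A1 A2 A3; apply: contra => /and4P[B0 B1 B2 B3].
have aux (a x : int) : ~~ ((p ^ v)%:Z %| a)%Z -> ((p ^ v)%:Z %| a * x)%Z -> (p%:Z %| x)%Z.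
  by move=> na; apply: contraLR => nx; rewrite Gauss_dvdzl // coprime_expz.
by apply/and4P; split; [move: B0|move: B1|move: B2|move: B3]; apply: aux.
Qed.

(** The general diagonal change of coordinates: the [a_i] multiply the coordinates and [b] the
    equations. Only congruences are asked for, so the [a_i] may depend on [K] and approximate p-adic
    square roots, while [v] is fixed. *)
Lemma lsol_scale (p v : nat) (f1 f2 f3 d1 d2 d3 g1 g2 g3 c1 c2 c3 : int) : prime p ->
  (forall K, exists a0 a1 a2 a3 b : int,
    [/\ ~~ ((p ^ v)%:Z %| a0)%Z, ~~ ((p ^ v)%:Z %| a1)%Z,
        ~~ ((p ^ v)%:Z %| a2)%Z & ~~ ((p ^ v)%:Z %| a3)%Z] /\
    [/\ ((p ^ K)%:Z %| g1 * a0 ^+ 2 - b * f1)%Z,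
        ((p ^ K)%:Z %| g2 * a0 ^+ 2 - b * f2)%Z &
        ((p ^ K)%:Z %| g3 * a0 ^+ 2 - b * f3)%Z] /\
    [/\ ((p ^ K)%:Z %| c1 * a1 ^+ 2 - b * d1)%Z,
        ((p ^ K)%:Z %| c2 * a2 ^+ 2 - b * d2)%Z &
        ((p ^ K)%:Z %| c3 * a3 ^+ 2 - b * d3)%Z]) ->
  lsol p f1 f2 f3 d1 d2 d3 -> lsol p g1 g2 g3 c1 c2 c3.
Proof.
move=> pp sc sol; apply: (lsol_bounded p v) => // K.
have [a0 [a1 [a2 [a3 [b [[A0 A1 A2 A3] [[G1 G2 G3] [C1 C2 C3]]]]]]]] := sc K.
have [t [u1 [u2 [u3 [[E1 E2 E3] prim]]]]] := sol K.
exists (a0 * t), (a1 * u1), (a2 * u2), (a3 * u3); split; last exact: alldvd_scale.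
have aux (g c c' f d d' a x x' s y y' : int) :
    ((p ^ K)%:Z %| g * a ^+ 2 - b * f)%Z -> ((p ^ K)%:Z %| c * x ^+ 2 - b * d)%Z ->
    ((p ^ K)%:Z %| c' * x' ^+ 2 - b * d')%Z ->
    ((p ^ K)%:Z %| f * s ^+ 2 + d * y ^+ 2 - d' * y' ^+ 2)%Z ->
    ((p ^ K)%:Z %| g * (a * s) ^+ 2 + c * (x * y) ^+ 2 - c' * (x' * y') ^+ 2)%Z.
  move=> H1 H2 H3 H4.
  have -> : g * (a * s) ^+ 2 + c * (x * y) ^+ 2 - c' * (x' * y') ^+ 2 =
    (g * a ^+ 2 - b * f) * s ^+ 2 + (c * x ^+ 2 - b * d) * y ^+ 2 -
    (c' * x' ^+ 2 - b * d') * y' ^+ 2 + b * (f * s ^+ 2 + d * y ^+ 2 - d' * y' ^+ 2) by ring.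
  by apply: rpredD; [apply: rpredB; [apply: rpredD|]|]; [exact: dvdz_mulr..|exact: dvdz_mull].
by split; apply: aux; eassumption.
Qed.

Lemma expn_ndvdz (p v : nat) (a : int) :
  prime p -> a != 0 -> (`|a| <= v)%N -> ~~ ((p ^ v)%:Z %| a)%Z.
Proof.
move=> pp a0 av; rewrite dvdzE gtnNdvd ?absz_gt0 //.
by apply: leq_ltn_trans av _; apply: ltn_expl; apply: prime_gt1.
Qed.

Lemma leq_sum4 (a b c d : nat) :
  [/\ (a <= a + b + c + d)%N, (b <= a + b + c + d)%N,
      (c <= a + b + c + d)%N & (d <= a + b + c + d)%N].
Proof. by split; lia. Qed.

Lemma lsol_scale_exact (p : nat) (f1 f2 f3 d1 d2 d3 g1 g2 g3 c1 c2 c3 a0 a1 a2 a3 b : int) :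
  prime p -> a0 != 0 -> a1 != 0 -> a2 != 0 -> a3 != 0 ->
  g1 * a0 ^+ 2 = b * f1 -> g2 * a0 ^+ 2 = b * f2 -> g3 * a0 ^+ 2 = b * f3 ->
  c1 * a1 ^+ 2 = b * d1 -> c2 * a2 ^+ 2 = b * d2 -> c3 * a3 ^+ 2 = b * d3 ->
  lsol p f1 f2 f3 d1 d2 d3 -> lsol p g1 g2 g3 c1 c2 c3.
Proof.
move=> pp A0 A1 A2 A3 G1 G2 G3 C1 C2 C3.
apply: (lsol_scale p (`|a0| + `|a1| + `|a2| + `|a3|)%N) => // K.
have [l0 l1 l2 l3] := leq_sum4 `|a0| `|a1| `|a2| `|a3|.
exists a0, a1, a2, a3, b; split; first by split; apply: expn_ndvdz.
by rewrite G1 G2 G3 C1 C2 C3 !subrr dvdz0.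
Qed.

Lemma lsol_rot (p : nat) (f1 f2 f3 d1 d2 d3 : int) :
  lsol p f1 f2 f3 d1 d2 d3 -> lsol p f2 f3 f1 d2 d3 d1.
Proof.
move=> sol K; have [t [u1 [u2 [u3 [[E1 E2 E3] prim]]]]] := sol K.
exists t, u2, u3, u1; split; first by split.
apply: contra prim => /and4P[? ? ? ?]; exact/and4P.
Qed.

(* Translation by the 2-torsion point with image [(-f2f3, f3, -f2)]. *)
Lemma lsol_translate (p : nat) (f1 f2 f3 d1 d2 d3 W : int) : prime p ->
  d1 != 0 -> d2 != 0 -> d3 != 0 -> d1 * d2 * d3 = W * W -> f1 + f2 + f3 = 0 ->
  lsol p f1 f2 f3 d1 d2 d3 ->
  lsol p f1 f2 f3 (- (f2 * f3) * d1) (f3 * d2) (- f2 * d3).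
Proof.
move=> pp D1 D2 D3 WE f0 sol.
have W0 : W != 0.
  by apply/eqP => W0; move: WE; rewrite W0 mulr0; apply/eqP; rewrite !mulf_neq0.
pose v := (absz (W ^+ 2)%R + absz (d2 * d3)%R + absz (W * d3)%R + absz (W * d2)%R)%N.
apply: (lsol_bounded p v) => // K.
have [t [u1 [u2 [u3 [[E1 E2 E3] prim]]]]] := sol K.
(* Over Q_p the translation sends [(t, u1, u2, u3)] to [(d1 * u1, t, W * u3 / d2, W * u2 / d3)]; the
   witnesses are these coordinates times [d2 * d3]. *)
exists (W ^+ 2 * u1), (d2 * d3 * t), (W * d3 * u3), (W * d2 * u2); split; last first.
  have [l0 l1 l2 l3] := leq_sum4 (absz (W ^+ 2)) (absz (d2 * d3)) (absz (W * d3)) (absz (W * d2)).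
  apply: alldvd_scale => //; try by apply: expn_ndvdz; rewrite ?mulf_neq0 ?expf_neq0.
  by apply: contra prim => /and4P[? ? ? ?]; apply/and4P.
have key2 : f2 * (W ^+ 2 * u1) ^+ 2 + - f2 * d3 * (W * d2 * u2) ^+ 2 -
    - (f2 * f3) * d1 * (d2 * d3 * t) ^+ 2 =
    f2 * d2 * d3 * W ^+ 2 * (f3 * t ^+ 2 + d1 * u1 ^+ 2 - d2 * u2 ^+ 2).
  transitivity (f2 * ((W * W) ^+ 2 * u1 ^+ 2) - f2 * d3 * d2 ^+ 2 * (W * W) * u2 ^+ 2 +
    f2 * f3 * d1 * d2 ^+ 2 * d3 ^+ 2 * t ^+ 2); first by ring.
  transitivity (f2 * d2 * d3 * (W * W) * (f3 * t ^+ 2 + d1 * u1 ^+ 2 - d2 * u2 ^+ 2));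
    last by ring.
  rewrite -WE; ring.
have key3 : f3 * (W ^+ 2 * u1) ^+ 2 + - (f2 * f3) * d1 * (d2 * d3 * t) ^+ 2 -
    f3 * d2 * (W * d3 * u3) ^+ 2 =
    - (f3 * d2 * d3 * W ^+ 2) * (f2 * t ^+ 2 + d3 * u3 ^+ 2 - d1 * u1 ^+ 2).
  transitivity (f3 * ((W * W) ^+ 2 * u1 ^+ 2) - f3 * d2 * d3 ^+ 2 * (W * W) * u3 ^+ 2 -
    f2 * f3 * d1 * d2 ^+ 2 * d3 ^+ 2 * t ^+ 2); first by ring.
  transitivity (- (f3 * d2 * d3 * (W * W)) * (f2 * t ^+ 2 + d3 * u3 ^+ 2 - d1 * u1 ^+ 2));
    last by ring.
  rewrite -WE; ring.
have P2 := dvdz_mull (f2 * d2 * d3 * W ^+ 2) E3; rewrite -key2 in P2.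
have P3 := dvdz_mull (- (f3 * d2 * d3 * W ^+ 2)) E2; rewrite -key3 in P3.
exact: dsol_of_two.
Qed.

(** * Hensel lifting of square roots and points at primes of good reduction *)

Lemma intr_Fp_eq0 (p : nat) (a : int) :
  prime p -> (a%:~R == 0 :> 'F_p) = (p%:Z %| a)%Z.
Proof. by move=> pp; rewrite (dvdz_pcharf (pchar_Fp pp)). Qed.

Lemma intr_Fp_surj (p : nat) (x : 'F_p) : prime p -> exists a : int, a%:~R = x.
Proof. by move=> pp; exists (x : nat)%:Z; rewrite -pmulrn natr_Zp. Qed.

Lemma sqb_FpP (p : nat) (a : int) : prime p ->
  reflect (exists s : int, (p%:Z %| s ^+ 2 - a)%Z) (sqb 'F_p a%:~R).
Proof.
move=> pp; apply: (iffP (sqbP _ _)) => [[y yE]|[s sE]].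
  have [s sE] := intr_Fp_surj p y pp; exists s.
  by rewrite -intr_Fp_eq0 // rmorphB rmorphXn /= sE yE subrr.
exists s%:~R; apply/eqP; rewrite -subr_eq0 -rmorphXn -rmorphB /=.
by rewrite intr_Fp_eq0.
Qed.

Lemma solve_linear_mod (p : nat) (r c : int) :
  prime p -> ~~ (p%:Z %| c)%Z -> exists h : int, (p%:Z %| r + c * h)%Z.
Proof.
move=> pp; rewrite -intr_Fp_eq0 // => c0.
have [h hE] := intr_Fp_surj p (- r%:~R / c%:~R) pp; exists h.
rewrite -intr_Fp_eq0 // rmorphD rmorphM /= hE.
by apply/eqP; field.
Qed.

(** This says that [a] is the square of a unit of Z_p; the roots at different levels need not be
    compatible. *)
Definition lsq (p : nat) (a : int) : Prop :=
  forall K, exists s : int, ((p ^ K)%:Z %| s ^+ 2 - a)%Z /\ ~~ (p%:Z %| s)%Z.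

Lemma lsq_mul (p : nat) (a b : int) : prime p -> lsq p a -> lsq p b -> lsq p (a * b).
Proof.
move=> pp la lb K; have [[s [sE sp]] [r [rE rp]]] := (la K, lb K).
exists (s * r); split; last by rewrite primez_dvdM // negb_or sp.
have -> : (s * r) ^+ 2 - a * b = (s ^+ 2 - a) * r ^+ 2 + a * (r ^+ 2 - b) by ring.
by apply: rpredD; [exact: dvdz_mulr | exact: dvdz_mull].
Qed.

Lemma lsq1 (p : nat) : prime p -> lsq p 1.
Proof.
move=> pp K; exists 1; rewrite expr1n subrr dvdz0 dvdz1; split=> //=.
by have := prime_gt1 pp; lia.
Qed.

Lemma sqr_unit_mod (p : nat) (s a : int) : prime p ->
  ~~ (p%:Z %| a)%Z -> (p%:Z %| s ^+ 2 - a)%Z -> ~~ (p%:Z %| s)%Z.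
Proof.
move=> pp pa sE; apply: contra pa => ps.
by rewrite -[a](subKr (s ^+ 2)) rpredB // primez_dvdX2.
Qed.

Lemma lsq_odd (p : nat) (a : int) : prime p -> odd p ->
  ~~ (p%:Z %| a)%Z -> sqb 'F_p a%:~R -> lsq p a.
Proof.
move=> pp podd pa /(sqb_FpP _ _ pp)[s0 s0E].
suff hensel K : exists s : int, ((p ^ K.+1)%:Z %| s ^+ 2 - a)%Z.
  move=> K; have [s sE] := hensel K; exists s; split; first exact: dvdz_expn_le sE.
  apply: sqr_unit_mod pa _ => //; rewrite -[X in X%:Z]expn1.
  exact: dvdz_expn_le sE.
elim: K => [|K [s sE]]; first by exists s0; rewrite expn1.
have ps : ~~ (p%:Z %| s)%Z.
  apply: sqr_unit_mod pa _ => //; rewrite -[X in X%:Z]expn1.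
  exact: dvdz_expn_le sE.
have p2s : ~~ (p%:Z %| 2 * s)%Z.
  rewrite primez_dvdM // negb_or ps andbT dvdzE /=; apply/negP => /(dvdn_leq (isT : (0 < 2)%N)).
  by rewrite leqNgt odd_prime_gt2.
case/dvdzP: sE => r rE; have [h hE] := solve_linear_mod p r (2 * s) pp p2s.
exists (s + (p ^ K.+1)%:Z * h).
have -> : (s + (p ^ K.+1)%:Z * h) ^+ 2 - a =
    (s ^+ 2 - a) + (p ^ K.+1)%:Z * (2 * s * h) + ((p ^ K.+1)%:Z * (p ^ K.+1)%:Z) * h ^+ 2 by ring.
rewrite rE [r * _]mulrC -mulrDr; apply: rpredD.
  by rewrite [in X in (X %| _)%Z]expnSr PoszM dvdz_mul.
apply: dvdz_mulr; rewrite -PoszM -expnD; apply: (dvdz_expn_le _ _ _ _ _ (dvdzz _)); lia.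
Qed.

Lemma lsq_two (a : int) : (8 %| a - 1)%Z -> lsq 2 a.
Proof.
move=> a8; have aodd : ~~ (2 %| a)%Z by lia.
suff hensel K : exists s : int, ((2 ^ (K + 3))%:Z %| s ^+ 2 - a)%Z.
  move=> K; have [s sE] := hensel K; exists s.
  split; first by apply: dvdz_expn_le sE; lia.
  apply: (sqr_unit_mod 2 s a) => //; apply: (dvdz_expn_le 2 1) sE; lia.
elim: K => [|K [s sE]]; first by exists 1; lia.
have sodd : ~~ (2 %| s)%Z.
  apply: (sqr_unit_mod 2 s a) => //; apply: (dvdz_expn_le 2 1) sE; lia.
(* The correction has one factor 2 less than the modulus, which the cross term supplies. The error
   becomes [r * (s + 1)] times the old modulus, up to a term of higher order, and [s + 1] is
   even. *)
case/dvdzP: sE => r rE; exists (s + (2 ^ (K + 2))%:Z * r).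
have -> : (s + (2 ^ (K + 2))%:Z * r) ^+ 2 - a =
    (s ^+ 2 - a) + (2 * (2 ^ (K + 2))%:Z) * (s * r) +
    ((2 ^ (K + 2))%:Z * (2 ^ (K + 2))%:Z) * r ^+ 2 by ring.
have E2 : 2 * (2 ^ (K + 2))%:Z = (2 ^ (K + 3))%:Z :> int.
  by rewrite -[2]/(2%:Z) -PoszM -expnS; congr (2 ^ _)%:Z; lia.
rewrite rE E2 [r * _]mulrC -mulrDr; apply: rpredD.
  rewrite (_ : (K.+1 + 3 = (K + 3).+1)%N); last by lia.
  rewrite [in X in (X %| _)%Z]expnSr PoszM dvdz_mul //.
  have [s' ->] : exists s', s = 2 * s' + 1 by exists (s %/ 2)%Z; lia.
  by apply/dvdzP; exists (r * (s' + 1)); ring.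
apply: dvdz_mulr; rewrite -PoszM -expnD; apply: (dvdz_expn_le _ _ _ _ _ (dvdzz _)); lia.
Qed.

(** The point is [t = 0], [u_i = 1 / sqrt d_i], with denominators cleared by the product of the
    three roots. *)
Lemma lsol_lsq (p : nat) (f1 f2 f3 d1 d2 d3 : int) : prime p -> f1 + f2 + f3 = 0 ->
  lsq p d1 -> lsq p d2 -> lsq p d3 -> lsol p f1 f2 f3 d1 d2 d3.
Proof.
move=> pp f0 l1 l2 l3 K.
have [[s1 [E1 P1]] [s2 [E2 P2]] [s3 [E3 P3]]] := And3 (l1 K) (l2 K) (l3 K).
exists 0, (s2 * s3), (s1 * s3), (s1 * s2); split; last first.
  by rewrite /alldvd !negb_and primez_dvdM // negb_or P2 P3 orbT.
apply: dsol_of_two => //; rewrite expr0n mulr0 add0r.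
  have -> : d3 * (s1 * s2) ^+ 2 - d1 * (s2 * s3) ^+ 2 =
    (d3 * (s1 ^+ 2 - d1) - d1 * (s3 ^+ 2 - d3)) * s2 ^+ 2 by ring.
  by apply: dvdz_mulr; apply: rpredB; apply: dvdz_mull.
have -> : d1 * (s2 * s3) ^+ 2 - d2 * (s1 * s3) ^+ 2 =
    (d1 * (s2 ^+ 2 - d2) - d2 * (s1 ^+ 2 - d1)) * s3 ^+ 2 by ring.
by apply: dvdz_mulr; apply: rpredB; apply: dvdz_mull.
Qed.

Lemma lsol_untwist (p : nat) (f1 f2 f3 d1 d2 d3 m x1 x2 x3 : int) : prime p ->
  lsq p m -> lsq p x1 -> lsq p x2 -> lsq p x3 ->
  lsol p (f1 * m) (f2 * m) (f3 * m) d1 d2 d3 ->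
  lsol p f1 f2 f3 (d1 * x1) (d2 * x2) (d3 * x3).
Proof.
move=> pp lm l1 l2 l3; apply: (lsol_scale p 1) => // K.
have L0 := lsq_mul _ _ _ pp lm (lsq_mul _ _ _ pp (lsq_mul _ _ _ pp l1 l2) l3).
have [[a0 [E0 P0]] [a1 [E1 P1]]] := (L0 K, lsq_mul _ _ _ pp l2 l3 K).
have [[a2 [E2 P2]] [a3 [E3 P3]]] := (lsq_mul _ _ _ pp l1 l3 K, lsq_mul _ _ _ pp l1 l2 K).
(* Multiplying the equations by [x1 * x2 * x3] turns [d1] into [d1 * x1] times the unit square
   [x2 * x3], and similarly for [d2] and [d3]; [a0] absorbs [m] as well. *)
exists a0, a1, a2, a3, (x1 * x2 * x3); rewrite expn1; split; first by split.
have aux (a e b : int) : ((p ^ K)%:Z %| a ^+ 2 - b)%Z -> ((p ^ K)%:Z %| e * a ^+ 2 - e * b)%Z.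
  by move=> H; rewrite -mulrBr dvdz_mull.
split; split.
- by have := aux a0 f1 _ E0; apply: dvdz_eqr; ring.
- by have := aux a0 f2 _ E0; apply: dvdz_eqr; ring.
- by have := aux a0 f3 _ E0; apply: dvdz_eqr; ring.
- by have := aux a1 (d1 * x1) _ E1; apply: dvdz_eqr; ring.
- by have := aux a2 (d2 * x2) _ E2; apply: dvdz_eqr; ring.
- by have := aux a3 (d3 * x3) _ E3; apply: dvdz_eqr; ring.
Qed.

(** Hensel lifting in [u2] and [u3] with [t] and [u1] kept fixed. The roots [s2] and [s3] stand for
    [d2 * u2] and [d3 * u3], so all coordinates are multiplied by [d2 * d3]. *)
Lemma lsol_lift (p : nat) (f1 f2 f3 d1 d2 d3 t u1 u2 u3 : int) :
  prime p -> odd p -> f1 + f2 + f3 = 0 ->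
  ~~ (p%:Z %| d2)%Z -> ~~ (p%:Z %| d3)%Z ->
  ~~ (p%:Z %| u2)%Z -> ~~ (p%:Z %| u3)%Z ->
  dsol p%:Z f1 f2 f3 d1 d2 d3 t u1 u2 u3 -> lsol p f1 f2 f3 d1 d2 d3.
Proof.
move=> pp podd f0 D2 D3 U2 U3 [_ E2 E3] K.
have root (d c u : int) : ~~ (p%:Z %| d)%Z -> ~~ (p%:Z %| u)%Z ->
    (p%:Z %| c - d * u ^+ 2)%Z -> lsq p (d * c).
  move=> pd pu cE; apply: lsq_odd => //.
    apply/negP; rewrite primez_dvdM // (negPf pd) /= => pc.
    have : (p%:Z %| d * u ^+ 2)%Z by rewrite -[d * _](subKr c) rpredB.
    by rewrite primez_dvdM // primez_dvdX2 // (negPf pd) (negPf pu).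
  apply/(sqb_FpP _ _ pp); exists (d * u).
  by have := dvdz_mull (- d) cE; apply: dvdz_eqr; ring.
have R2 : lsq p (d2 * (f3 * t ^+ 2 + d1 * u1 ^+ 2)) by apply: root U2 E3.
have R3 : lsq p (d3 * (d1 * u1 ^+ 2 - f2 * t ^+ 2)).
  apply: root U3 _ => //; have := dvdzN _ _ E2; apply: dvdz_eqr; ring.
have [[s2 [S2 P2]] [s3 [S3 P3]]] := (R2 K, R3 K).
exists (d2 * d3 * t), (d2 * d3 * u1), (s2 * d3), (s3 * d2); split; last first.
  by rewrite /alldvd !negb_and !primez_dvdM // !negb_or P2 D3 /= !orbT.
apply: dsol_of_two => //.
  have := dvdz_mull (d3 * d2 ^+ 2) S3; apply: dvdz_eqr; ring.
have := dvdz_mull (- (d2 * d3 ^+ 2)) S2; apply: dvdz_eqr; ring.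
Qed.

Lemma lsol_good (p : nat) (f1 f2 f3 d1 d2 d3 W : int) :
  prime p -> odd p -> f1 + f2 + f3 = 0 -> d1 * d2 * d3 = W * W ->
  ~~ (p%:Z %| f1)%Z -> ~~ (p%:Z %| f2)%Z -> ~~ (p%:Z %| f3)%Z ->
  ~~ (p%:Z %| d1)%Z -> ~~ (p%:Z %| d2)%Z -> ~~ (p%:Z %| d3)%Z ->
  lsol p f1 f2 f3 d1 d2 d3.
Proof.
move=> pp podd f0 WE F1 F2 F3 D1 D2 D3.
have nz (a : int) : ~~ (p%:Z %| a)%Z -> a%:~R != 0 :> 'F_p by rewrite intr_Fp_eq0.
have pW : ~~ (p%:Z %| W)%Z.
  apply/negP => pW; have := dvdz_mulr W pW.
  by rewrite -WE !primez_dvdM // (negPf D1) (negPf D2) (negPf D3).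
have two : 2%:R != 0 :> 'F_p.
  by rewrite natr_Fp_eq0 //; apply/negP => /(dvdn_leq (isT : (0 < 2)%N)); rewrite leqNgt odd_prime_gt2.
have fE : f3 + f2 = - f1 by apply/eqP; rewrite -subr_eq0 -f0; apply/eqP; ring.
have [|||||||x [y1 [y2 [y3 [Y2 Y3 prim]]]]] := curve_point 'F_p d1%:~R d2%:~R d3%:~R f3%:~R (- f2%:~R) two;
  rewrite ?oppr_eq0; try exact: nz.
- by rewrite -addr_eq0 -rmorphD /= fE rmorphN oppr_eq0 nz.
- by rewrite -!rmorphM /= WE rmorphM /= -expr2 qchar_sqr // nz.
have [[t tE] [u1 u1E]] := (intr_Fp_surj p x pp, intr_Fp_surj p y1 pp).
have [[u2 u2E] [u3 u3E]] := (intr_Fp_surj p y2 pp, intr_Fp_surj p y3 pp).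
have S : dsol p%:Z f1 f2 f3 d1 d2 d3 t u1 u2 u3.
  move: Y2 Y3; rewrite !expr2 => Y2 Y3.
  apply: dsol_of_two => //; rewrite !expr2 -intr_Fp_eq0 // rmorphB rmorphD !rmorphM /=;
    rewrite tE u1E ?u2E ?u3E ?Y2 ?Y3; apply/eqP; ring.
have prim' : ~~ alldvd p%:Z t u1 u2 u3.
  by rewrite /alldvd -!intr_Fp_eq0 // tE u1E u2E u3E.
case: (S) => E1 E2 E3.
(* If [p] divides one [u_i], it divides [t] and the other two together or not at all. Primitivity
   excludes the former, so at least two of the [u_i] are units, and a rotation brings them to the
   places of [u2] and [u3]. *)
have one (f d d' s v v' : int) : ~~ (p%:Z %| f)%Z -> ~~ (p%:Z %| d')%Z ->
   (p%:Z %| f * s ^+ 2 + d * v ^+ 2 - d' * v' ^+ 2)%Z ->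
   (p%:Z %| v)%Z -> (p%:Z %| s)%Z = (p%:Z %| v')%Z.
  move=> pf pd' H pv; have pdv : (p%:Z %| d * v ^+ 2)%Z by rewrite dvdz_mull ?primez_dvdX2.
  have H' : (p%:Z %| f * s ^+ 2 - d' * v' ^+ 2)%Z.
    by have := dvdzB _ _ _ H pdv; apply: dvdz_eqr; ring.
  have : (p%:Z %| f * s ^+ 2)%Z = (p%:Z %| d' * v' ^+ 2)%Z.
    by rewrite -[f * _](subrK (d' * v' ^+ 2)) rpredDl.
  by rewrite !primez_dvdM // !orbb (negPf pf) (negPf pd').
have one' (f d d' s v v' : int) : ~~ (p%:Z %| f)%Z -> ~~ (p%:Z %| d)%Z ->
   (p%:Z %| f * s ^+ 2 + d * v ^+ 2 - d' * v' ^+ 2)%Z ->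
   (p%:Z %| v')%Z -> (p%:Z %| s)%Z = (p%:Z %| v)%Z.
  move=> pf pd H pv; apply: (one f (- d') (- d) s v' v) pv => //; first by rewrite rpredN.
  by move: H; apply: dvdz_eqr; ring.
have [p1|p1] := boolP (p%:Z %| u1)%Z.
  have H3 := one' _ _ _ _ _ _ F2 D3 E2 p1; have H2 := one _ _ _ _ _ _ F3 D2 E3 p1.
  have pt : ~~ (p%:Z %| t)%Z.
    by apply: contra prim' => pt; apply/and4P; split=> //; rewrite -?H2 -?H3.
  by apply: (lsol_lift _ _ _ _ _ _ _ t u1 u2 u3) => //; rewrite -?H2 -?H3.
have [p2|p2] := boolP (p%:Z %| u2)%Z.
  have H1 := one' _ _ _ _ _ _ F3 D1 E3 p2; have H3 := one _ _ _ _ _ _ F1 D3 E1 p2.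
  apply/lsol_rot/lsol_rot; apply: (lsol_lift _ _ _ _ _ _ _ t u2 u3 u1) => //.
  - by rewrite -f0; ring.
  - by rewrite -H3 H1.
have [p3|p3] := boolP (p%:Z %| u3)%Z; last by apply: (lsol_lift _ _ _ _ _ _ _ t u1 u2 u3).
apply/lsol_rot; apply: (lsol_lift _ _ _ _ _ _ _ t u3 u1 u2) => //.
by rewrite -f0; ring.
Qed.

(** * Valuations at good primes and local conditions at twisted primes *)

Lemma dvdz_ndvd_neq0 (M a : int) : ~~ (M %| a)%Z -> a != 0.
Proof. by apply: contraNneq => ->; apply: dvdz0. Qed.

Lemma posz_expn (p k : nat) : (p ^ k)%:Z = p%:Z ^+ k.
Proof. by rewrite -!natz natrX. Qed.

Lemma square_split (p : nat) (d : int) : prime p -> d != 0 ->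
  exists c a : int, [/\ d = c * a ^+ 2, a != 0, ~~ (p%:Z ^+ 2 %| c)%Z &
    (p%:Z %| c)%Z = odd (logn p `|d|)].
Proof.
move=> pp d0; have d0' : (0 < `|d|)%N by rewrite absz_gt0.
have [m com mE] := pfactor_coprime pp d0'.
set v := logn p `|d| in mE *.
have pm : ~~ (p%:Z %| m%:Z)%Z by rewrite dvdzE /= -prime_coprime.
have p0 : p%:Z != 0 by rewrite eqz_nat -lt0n prime_gt0.
pose s : int := (-1) ^+ (d < 0)%R.
have s1 : s * s = 1 by rewrite /s; case: (d < 0).
have us (a b : int) : (a %| s * b)%Z = (a %| b)%Z.
  apply/idP/idP => [h|]; last exact: dvdz_mull.
  by rewrite -[b]mul1r -s1 -mulrA dvdz_mull.
exists (s * (m%:Z * p%:Z ^+ odd v)), (p%:Z ^+ v./2); split.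
- rewrite [LHS]intEsign -/s mE PoszM -!mulrA; congr (_ * (_ * _)).
  by rewrite posz_expn -exprM -exprD muln2 odd_double_half.
- by rewrite expf_neq0.
- rewrite us; case: (odd v).
    by rewrite expr2 expr1 dvdz_mul2r.
  rewrite expr0 mulr1; apply: contra pm => h; apply: dvdz_trans h.
  by rewrite expr2 dvdz_mulr.
- rewrite us; case: (odd v); first by rewrite expr1 dvdz_mull.
  by rewrite expr0 mulr1 (negPf pm).
Qed.

(** Modulo [p] the equations force [p] to divide [t] and [u1]; modulo [p ^ 2] they then force it to
    divide [u2] and [u3], against primitivity. *)
Lemma lsol_ramified_contra (p : nat) (f1 f2 f3 d1 d2 d3 : int) : prime p ->
  ~~ (p%:Z %| f1)%Z -> ~~ (p%:Z %| d1)%Z ->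
  (p%:Z %| d2)%Z -> (p%:Z %| d3)%Z ->
  ~~ (p%:Z ^+ 2 %| d2)%Z -> ~~ (p%:Z ^+ 2 %| d3)%Z ->
  ~ lsol p f1 f2 f3 d1 d2 d3.
Proof.
move=> pp F1 D1 /dvdzP[c2 c2E] /dvdzP[c3 c3E] N2 N3 sol.
have p0 : p%:Z != 0 by rewrite eqz_nat -lt0n prime_gt0.
have C2 : ~~ (p%:Z %| c2)%Z by apply: contra N2; rewrite c2E expr2 dvdz_mul2r.
have C3 : ~~ (p%:Z %| c3)%Z by apply: contra N3; rewrite c3E expr2 dvdz_mul2r.
have [t [u1 [u2 [u3 [[E1 E2 E3] prim]]]]] := sol 2%N.
rewrite c2E c3E in E1 E2 E3.
have weak (z : int) : ((p ^ 2)%:Z %| z)%Z -> (p%:Z %| z)%Z.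
  by move/(dvdz_expn_le p 1 2); rewrite expn1; apply.
have sq2 (z : int) : (p%:Z %| z)%Z -> ((p ^ 2)%:Z %| z ^+ 2)%Z.
  by move=> pz; rewrite !expr2 -[(p ^ 2)%:Z]/((p * p)%:Z) PoszM dvdz_mul.
have pt : (p%:Z %| t)%Z.
  have : (p%:Z %| f1 * t ^+ 2)%Z.
    have := dvdzB _ _ _ (weak _ E1) (dvdz_mull (c2 * u2 ^+ 2 - c3 * u3 ^+ 2) (dvdzz p%:Z)).
    by apply: dvdz_eqr; ring.
  by rewrite primez_dvdM // (negPf F1) /= primez_dvdX2.
have p1 : (p%:Z %| u1)%Z.
  have : (p%:Z %| d1 * u1 ^+ 2)%Z.
    have := dvdzB _ _ _ (weak _ E3) (dvdzD _ _ _ (dvdz_mull (f3 * t) pt)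
      (dvdz_mull (- c2 * u2 ^+ 2) (dvdzz p%:Z))).
    by apply: dvdz_eqr; ring.
  by rewrite primez_dvdM // (negPf D1) /= primez_dvdX2.
have fin (c u : int) : ~~ (p%:Z %| c)%Z -> ((p ^ 2)%:Z %| c * p%:Z * u ^+ 2)%Z -> (p%:Z %| u)%Z.
  move=> pc; rewrite -[(p ^ 2)%:Z]/((p * p)%:Z) PoszM mulrAC dvdz_mul2r //.
  by rewrite primez_dvdM // (negPf pc) /= primez_dvdX2.
have p2 : (p%:Z %| u2)%Z.
  apply: fin C2 _; have := dvdzB _ _ _ (dvdzD _ _ _ (dvdz_mull f3 (sq2 _ pt)) (dvdz_mull d1 (sq2 _ p1))) E3.
  by apply: dvdz_eqr; ring.
have p3 : (p%:Z %| u3)%Z.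
  apply: fin C3 _; have := dvdzB _ _ _ E2 (dvdzB _ _ _ (dvdz_mull f2 (sq2 _ pt)) (dvdz_mull d1 (sq2 _ p1))).
  by apply: dvdz_eqr; ring.
by move/negP: prim; apply; apply/and4P.
Qed.

Lemma logn_square_prod (p : nat) (d1 d2 d3 W : int) : prime p ->
  d1 != 0 -> d2 != 0 -> d3 != 0 -> d1 * d2 * d3 = W * W ->
  odd (logn p `|d1|) (+) odd (logn p `|d2|) (+) odd (logn p `|d3|) = false.
Proof.
move=> pp D1 D2 D3 WE; rewrite -!oddD -!lognM ?muln_gt0 ?absz_gt0 ?D1 ?D2 //.
rewrite -!abszM WE abszM lognM ?oddD ?addbb // absz_gt0;
  by apply: contraTneq (mulf_neq0 (mulf_neq0 D1 D2) D3) => W0; rewrite WE W0 mulr0 eqxx.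
Qed.

(** Since the product is a square, the only other possibility is that exactly two valuations are
    odd; after splitting off squares and rotating, [lsol_ramified_contra] excludes it. *)
Lemma lsol_even_val (p : nat) (f1 f2 f3 d1 d2 d3 W : int) : prime p ->
  ~~ (p%:Z %| f1)%Z -> ~~ (p%:Z %| f2)%Z -> ~~ (p%:Z %| f3)%Z ->
  d1 != 0 -> d2 != 0 -> d3 != 0 -> d1 * d2 * d3 = W * W ->
  lsol p f1 f2 f3 d1 d2 d3 ->
  [/\ ~~ odd (logn p `|d1|), ~~ odd (logn p `|d2|) & ~~ odd (logn p `|d3|)].
Proof.
move=> pp F1 F2 F3 D1 D2 D3 WE sol.
have := logn_square_prod _ _ _ _ _ pp D1 D2 D3 WE.
have [c1 [a1 [E1 A1 N1 <-]]] := square_split _ _ pp D1.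
have [c2 [a2 [E2 A2 N2 <-]]] := square_split _ _ pp D2.
have [c3 [a3 [E3 A3 N3 <-]]] := square_split _ _ pp D3.
have sol' : lsol p f1 f2 f3 c1 c2 c3.
  apply: (lsol_scale_exact p _ _ _ _ _ _ _ _ _ _ _ _ 1 a1 a2 a3 1) sol;
    by rewrite ?expr1n ?mulr1 ?mul1r.
have [P1|P1] := boolP (p%:Z %| c1)%Z; have [P2|P2] := boolP (p%:Z %| c2)%Z;
  have [P3|P3] := boolP (p%:Z %| c3)%Z => //= _; exfalso.
- by apply: (lsol_ramified_contra p f3 f1 f2 c3 c1 c2) (lsol_rot _ _ _ _ _ _ _ (lsol_rot _ _ _ _ _ _ _ sol')).
- by apply: (lsol_ramified_contra p f2 f3 f1 c2 c3 c1) (lsol_rot _ _ _ _ _ _ _ sol').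
- by apply: (lsol_ramified_contra p f1 f2 f3 c1 c2 c3) sol'.
Qed.

Lemma square_prod_split (c1 c2 c3 a1 a2 a3 W : int) :
  a1 != 0 -> a2 != 0 -> a3 != 0 ->
  (c1 * a1 ^+ 2) * (c2 * a2 ^+ 2) * (c3 * a3 ^+ 2) = W * W ->
  exists w : int, c1 * c2 * c3 = w * w.
Proof.
move=> A1 A2 A3 WE.
have E : (c1 * c2 * c3) * (a1 * a2 * a3) ^+ 2 = W ^+ 2 by rewrite [RHS]expr2 -WE; ring.
have /dvdzP[w wE] : (a1 * a2 * a3 %| W)%Z.
  by rewrite -(dvdz_pexp2r _ _ (isT : (0 < 2)%N)) -E dvdz_mull.
exists w; apply: (mulIf (expf_neq0 2 (mulf_neq0 (mulf_neq0 A1 A2) A3))).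
by rewrite E wE; ring.
Qed.

Lemma lsol_good_even (p : nat) (f1 f2 f3 d1 d2 d3 W : int) :
  prime p -> odd p -> f1 + f2 + f3 = 0 ->
  ~~ (p%:Z %| f1)%Z -> ~~ (p%:Z %| f2)%Z -> ~~ (p%:Z %| f3)%Z ->
  d1 != 0 -> d2 != 0 -> d3 != 0 -> d1 * d2 * d3 = W * W ->
  ~~ odd (logn p `|d1|) -> ~~ odd (logn p `|d2|) -> ~~ odd (logn p `|d3|) ->
  lsol p f1 f2 f3 d1 d2 d3.
Proof.
move=> pp podd f0 F1 F2 F3 D1 D2 D3 WE.
have [c1 [a1 [E1 A1 N1 <-]]] := square_split _ _ pp D1.
have [c2 [a2 [E2 A2 N2 <-]]] := square_split _ _ pp D2.
have [c3 [a3 [E3 A3 N3 <-]]] := square_split _ _ pp D3.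
move=> C1 C2 C3; rewrite E1 E2 E3 in WE.
have [w wE] := square_prod_split _ _ _ _ _ _ _ A1 A2 A3 WE.
have := lsol_good p f1 f2 f3 c1 c2 c3 w pp podd f0 wE F1 F2 F3 C1 C2 C3.
apply: (lsol_scale_exact p _ _ _ _ _ _ _ _ _ _ _ _
  (a1 * a2 * a3) (a2 * a3) (a1 * a3) (a1 * a2) ((a1 * a2 * a3) ^+ 2)) => //;
  rewrite ?mulf_neq0 // ?E1 ?E2 ?E3; ring.
Qed.

Lemma sqb_mull (p : nat) (x y : int) : prime p ->
  ~~ (p%:Z %| x)%Z -> ~~ (p%:Z %| y)%Z -> sqb 'F_p x%:~R ->
  sqb 'F_p (x * y)%:~R = sqb 'F_p y%:~R.
Proof.
move=> pp; rewrite -!intr_Fp_eq0 // => X Y sx.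
by rewrite rmorphM /= sqb_mul // sx; case: (sqb _ y%:~R).
Qed.

Lemma sqb_sqr (p : nat) (x : int) : sqb 'F_p (x ^+ 2)%:~R.
Proof. by apply/sqbP; exists x%:~R; rewrite rmorphXn. Qed.

(** Modulo [p] the three [d_i * u_i ^+ 2] agree, and the [u_i] are units because [p ^ 2] does not
    divide [f1]. Hence the [d_i] lie in one square class, which is trivial as their product is a
    square. The converse is the point with [t = 0]. *)
Lemma lsol_twisted_unit (p : nat) (f1 f2 f3 d1 d2 d3 W : int) :
  prime p -> odd p -> f1 + f2 + f3 = 0 ->
  (p%:Z %| f1)%Z -> (p%:Z %| f2)%Z -> (p%:Z %| f3)%Z -> ~~ (p%:Z ^+ 2 %| f1)%Z ->
  ~~ (p%:Z %| d1)%Z -> ~~ (p%:Z %| d2)%Z -> ~~ (p%:Z %| d3)%Z ->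
  d1 * d2 * d3 = W * W ->
  lsol p f1 f2 f3 d1 d2 d3 <->
  [/\ sqb 'F_p d1%:~R, sqb 'F_p d2%:~R & sqb 'F_p d3%:~R].
Proof.
move=> pp podd f0 F1 F2 F3 N1 D1 D2 D3 WE; split=> [sol|[S1 S2 S3]]; last first.
  by apply: lsol_lsq => //; apply: lsq_odd.
have p0 : p%:Z != 0 by rewrite eqz_nat -lt0n prime_gt0.
have [t [u1 [u2 [u3 [[E1 E2 E3] prim]]]]] := sol 2%N.
have weak (z : int) : ((p ^ 2)%:Z %| z)%Z -> (p%:Z %| z)%Z.
  by move/(dvdz_expn_le p 1 2); rewrite expn1; apply.
have sq2 (z : int) : (p%:Z %| z)%Z -> ((p ^ 2)%:Z %| z ^+ 2)%Z.
  by move=> pz; rewrite !expr2 -[(p ^ 2)%:Z]/((p * p)%:Z) PoszM dvdz_mul.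
have red (f d d' v v' : int) : (p%:Z %| f)%Z ->
    ((p ^ 2)%:Z %| f * t ^+ 2 + d * v ^+ 2 - d' * v' ^+ 2)%Z ->
    (p%:Z %| d * v ^+ 2 - d' * v' ^+ 2)%Z.
  move=> pf /weak H; have := dvdzB _ _ _ H (dvdz_mulr (t ^+ 2) pf).
  by apply: dvdz_eqr; ring.
move: (red _ _ _ _ _ F1 E1) (red _ _ _ _ _ F2 E2) (red _ _ _ _ _ F3 E3) => R1 R2 R3.
have same (d d' v v' : int) : ~~ (p%:Z %| d)%Z -> ~~ (p%:Z %| d')%Z ->
    (p%:Z %| d * v ^+ 2 - d' * v' ^+ 2)%Z -> (p%:Z %| v)%Z = (p%:Z %| v')%Z.
  move=> pd pd' H; have : (p%:Z %| d * v ^+ 2)%Z = (p%:Z %| d' * v' ^+ 2)%Z.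
    by rewrite -[d * _](subrK (d' * v' ^+ 2)) rpredDl.
  by rewrite !primez_dvdM // !orbb (negPf pd) (negPf pd').
have S1 := same _ _ _ _ D2 D3 R1; have S2 := same _ _ _ _ D3 D1 R2.
have U1 : ~~ (p%:Z %| u1)%Z.
  apply: contra prim => p1; have p3 : (p%:Z %| u3)%Z by rewrite S2.
  have p2 : (p%:Z %| u2)%Z by rewrite S1.
  apply/and4P; split=> //.
  have : ((p ^ 2)%:Z %| f1 * t ^+ 2)%Z.
    have := dvdzB _ _ _ E1 (dvdzB _ _ _ (dvdz_mull d2 (sq2 _ p2)) (dvdz_mull d3 (sq2 _ p3))).
    by apply: dvdz_eqr; ring.
  case/dvdzP: F1 => g gE; rewrite gE -[(p ^ 2)%:Z]/((p * p)%:Z) PoszM mulrAC dvdz_mul2r //.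
  have pg : ~~ (p%:Z %| g)%Z by apply: contra N1; rewrite gE expr2 dvdz_mul2r.
  by rewrite primez_dvdM // (negPf pg) /= primez_dvdX2.
have U3 : ~~ (p%:Z %| u3)%Z by rewrite S2.
have U2 : ~~ (p%:Z %| u2)%Z by rewrite S1.
have sqpair (d d' v v' : int) : ~~ (p%:Z %| d)%Z -> ~~ (p%:Z %| d')%Z ->
    ~~ (p%:Z %| v)%Z -> ~~ (p%:Z %| v')%Z ->
    (p%:Z %| d * v ^+ 2 - d' * v' ^+ 2)%Z -> sqb 'F_p d%:~R = sqb 'F_p d'%:~R.
  move=> pd pd' pv pv'; rewrite -intr_Fp_eq0 // rmorphB /= subr_eq0 => /eqP E.
  have sv (a : int) : ~~ (p%:Z %| a)%Z -> ~~ (p%:Z %| a ^+ 2)%Z by rewrite primez_dvdX2.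
  rewrite -(sqb_mull p (v ^+ 2) d) ?sqb_sqr ?sv // mulrC E mulrC.
  by rewrite sqb_mull ?sqb_sqr ?sv.
have Q1 := sqpair _ _ _ _ D2 D3 U2 U3 R1; have Q2 := sqpair _ _ _ _ D3 D1 U3 U1 R2.
have : sqb 'F_p (d1 * d2 * d3)%:~R by rewrite WE -expr2 sqb_sqr.
move: D1 D2 D3; rewrite -!intr_Fp_eq0 // => D1 D2 D3.
rewrite !rmorphM /= !sqb_mul ?mulf_neq0 // Q1 Q2.
by case: (sqb _ d1%:~R).
Qed.

Lemma lsol_translateP (p : nat) (f1 f2 f3 d1 d2 d3 W : int) : prime p ->
  f1 != 0 -> f2 != 0 -> f3 != 0 ->
  d1 != 0 -> d2 != 0 -> d3 != 0 -> d1 * d2 * d3 = W * W -> f1 + f2 + f3 = 0 ->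
  lsol p f1 f2 f3 d1 d2 d3 <->
  lsol p f1 f2 f3 (- (f2 * f3) * d1) (f3 * d2) (- f2 * d3).
Proof.
move=> pp F1 F2 F3 D1 D2 D3 WE f0; split; first exact: lsol_translate WE f0.
move/(lsol_translate p _ _ _ _ _ _ (f2 * f3 * W) pp) => /(_ _ _ _ _ f0) sol.
apply: (lsol_scale_exact p _ _ _ _ _ _ _ _ _ _ _ _ 1 (f2 * f3) f3 f2 1)
  (sol _ _ _ _) => //; rewrite ?mulf_neq0 ?oppr_eq0 ?mulf_neq0 //; try by ring.
by transitivity ((f2 * f3) ^+ 2 * (d1 * d2 * d3)); [ring | rewrite WE; ring].
Qed.

Lemma lsol_sqr_scale (p : nat) (f1 f2 f3 d1 d2 d3 a : int) : prime p -> a != 0 ->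
  lsol p f1 f2 f3 (d1 * a ^+ 2) (d2 * a ^+ 2) (d3 * a ^+ 2) <->
  lsol p f1 f2 f3 d1 d2 d3.
Proof.
move=> pp a0; split.
  by apply: (lsol_scale_exact p _ _ _ _ _ _ _ _ _ _ _ _ 1 a a a 1);
    rewrite ?oner_eq0 // ?mul1r // expr1n mulr1.
apply: (lsol_scale_exact p _ _ _ _ _ _ _ _ _ _ _ _ a 1 1 1 (a ^+ 2));
  rewrite ?oner_eq0 //; ring.
Qed.

(** Translation makes all three entries units times [p ^ 2]; the factors [-1], [e2], [e3] that it
    introduces are squares modulo [p], which leaves the criterion of [lsol_twisted_unit]. *)
Lemma lsol_twisted_ramified (p : nat) (e1 e2 e3 n' d1 c2 c3 W : int) :
  prime p -> odd p -> e1 + e2 + e3 = 0 -> sqb 'F_p (-1)%:~R ->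
  ~~ (p%:Z %| e1)%Z -> ~~ (p%:Z %| e2)%Z -> ~~ (p%:Z %| e3)%Z ->
  sqb 'F_p e2%:~R -> sqb 'F_p e3%:~R ->
  ~~ (p%:Z %| n')%Z -> ~~ (p%:Z %| d1)%Z -> ~~ (p%:Z %| c2)%Z -> ~~ (p%:Z %| c3)%Z ->
  d1 * (c2 * p%:Z) * (c3 * p%:Z) = W * W ->
  lsol p (e1 * (n' * p%:Z)) (e2 * (n' * p%:Z)) (e3 * (n' * p%:Z)) d1 (c2 * p%:Z) (c3 * p%:Z) <->
  [/\ sqb 'F_p d1%:~R, sqb 'F_p (n' * c2)%:~R & sqb 'F_p (n' * c3)%:~R].
Proof.
move=> pp podd e0 sN1 P1 P2 P3 S2 S3 PN PD PC2 PC3 WE.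
have p0 : p%:Z != 0 by rewrite eqz_nat -lt0n prime_gt0.
have nz (a : int) : ~~ (p%:Z %| a)%Z -> a != 0 by apply: dvdz_ndvd_neq0.
have uM (a b : int) : ~~ (p%:Z %| a)%Z -> ~~ (p%:Z %| b)%Z -> ~~ (p%:Z %| a * b)%Z.
  by move=> ? ?; rewrite primez_dvdM // negb_or; apply/andP.
have uN1 : ~~ (p%:Z %| (-1)%R)%Z by rewrite rpredN dvdz1 /= neq_ltn prime_gt1 // orbT.
have sM (a b : int) : sqb 'F_p a%:~R -> sqb 'F_p b%:~R -> sqb 'F_p (a * b)%:~R.
  by move=> /sqbP[x xE] /sqbP[y yE]; apply/sqbP; exists (x * y); rewrite exprMn xE yE rmorphM.
have [w wE] : exists w : int, d1 * c2 * c3 = w * w.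
  apply: (square_prod_split d1 c2 c3 p%:Z 1 1 W) => //.
  by rewrite -WE; ring.
have NP : n' * p%:Z != 0 by apply: mulf_neq0 => //; apply: nz.
have f0 : e1 * (n' * p%:Z) + e2 * (n' * p%:Z) + e3 * (n' * p%:Z) = 0.
  by rewrite -!mulrDl e0 mul0r.
rewrite (lsol_translateP p _ _ _ _ _ _ W pp
  (mulf_neq0 (nz _ P1) NP) (mulf_neq0 (nz _ P2) NP) (mulf_neq0 (nz _ P3) NP)
  (nz _ PD) (mulf_neq0 (nz _ PC2) p0) (mulf_neq0 (nz _ PC3) p0) WE f0).
have -> : - (e2 * (n' * p%:Z) * (e3 * (n' * p%:Z))) * d1 =
  (-1 * (e2 * e3) * n' ^+ 2) * d1 * p%:Z ^+ 2 by ring.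
have -> : e3 * (n' * p%:Z) * (c2 * p%:Z) = e3 * (n' * c2) * p%:Z ^+ 2 by ring.
have -> : - (e2 * (n' * p%:Z)) * (c3 * p%:Z) = (-1 * e2) * (n' * c3) * p%:Z ^+ 2 by ring.
rewrite lsol_sqr_scale //.
rewrite (lsol_twisted_unit p _ _ _ _ _ _ (e2 * e3 * n' ^+ 2 * w)) //.
- have Q1 : sqb 'F_p (-1 * (e2 * e3) * n' ^+ 2)%:~R.
    exact: (sM _ _ (sM _ _ sN1 (sM _ _ S2 S3)) (sqb_sqr _ _)).
  have U1 : ~~ (p%:Z %| (-1 * (e2 * e3) * n' ^+ 2)%R)%Z.
    by apply: (uM _ _ (uM _ _ uN1 (uM _ _ P2 P3))); rewrite primez_dvdX2.
  rewrite (sqb_mull p _ d1 pp U1 PD Q1).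
  rewrite (sqb_mull p e3 _ pp P3 (uM _ _ PN PC2) S3).
  by rewrite (sqb_mull p _ _ pp (uM _ _ uN1 P2) (uM _ _ PN PC3) (sM _ _ sN1 S2)).
- by rewrite mulrA dvdz_mull.
- by rewrite mulrA dvdz_mull.
- by rewrite mulrA dvdz_mull.
- by rewrite expr2 mulrA dvdz_mul2r // uM.
- by rewrite expr2; exact: (uM _ _ (uM _ _ (uM _ _ uN1 (uM _ _ P2 P3)) (uM _ _ PN PN)) PD).
- exact: (uM _ _ P3 (uM _ _ PN PC2)).
- exact: (uM _ _ (uM _ _ uN1 P2) (uM _ _ PN PC3)).
transitivity ((e2 * e3 * n' ^+ 2) ^+ 2 * (d1 * c2 * c3)); first by ring.
by rewrite wE; ring.
Qed.

(* The residue class deciding solvability at [p] when [n = n' * p]: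
   for a multiple [d] of [p] it is that of the translate [n d / p ^+ 2]. *)
Definition local_unit (p : nat) (n' d : int) : int :=
  if (p%:Z %| d)%Z then n' * (d %/ p%:Z)%Z else d.

Lemma odd_logn_dvdz (p : nat) (d : int) : prime p ->
  ~~ (p%:Z ^+ 2 %| d)%Z -> (p%:Z %| d)%Z = odd (logn p `|d|).
Proof.
move=> pp N; have d0 : (0 < `|d|)%N by rewrite absz_gt0 (dvdz_ndvd_neq0 _ _ N).
have : (logn p `|d| < 2)%N.
  by rewrite ltnNge -pfactor_dvdn //; move: N; rewrite -posz_expn dvdzE.
rewrite dvdzE /= -[p in LHS]expn1 pfactor_dvdn //.
by case: (logn p `|d|) => [|[|]].
Qed.

(** As the product is a square, either all [d_i] are prime to [p] or exactly two are divisible by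
    it; the latter gives the three rotations of [lsol_twisted_ramified]. *)
Lemma lsol_twisted (p : nat) (e1 e2 e3 n' d1 d2 d3 W : int) :
  prime p -> odd p -> e1 + e2 + e3 = 0 -> sqb 'F_p (-1)%:~R ->
  ~~ (p%:Z %| e1)%Z -> ~~ (p%:Z %| e2)%Z -> ~~ (p%:Z %| e3)%Z ->
  sqb 'F_p e1%:~R -> sqb 'F_p e2%:~R -> sqb 'F_p e3%:~R ->
  ~~ (p%:Z %| n')%Z ->
  ~~ (p%:Z ^+ 2 %| d1)%Z -> ~~ (p%:Z ^+ 2 %| d2)%Z -> ~~ (p%:Z ^+ 2 %| d3)%Z ->
  d1 * d2 * d3 = W * W ->
  lsol p (e1 * (n' * p%:Z)) (e2 * (n' * p%:Z)) (e3 * (n' * p%:Z)) d1 d2 d3 <->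
  [/\ sqb 'F_p (local_unit p n' d1)%:~R, sqb 'F_p (local_unit p n' d2)%:~R &
      sqb 'F_p (local_unit p n' d3)%:~R].
Proof.
move=> pp podd e0 sN1 P1 P2 P3 S1 S2 S3 PN N1 N2 N3 WE.
have p0 : p%:Z != 0 by rewrite eqz_nat -lt0n prime_gt0.
have nz (d : int) : ~~ (p%:Z ^+ 2 %| d)%Z -> d != 0 by apply: dvdz_ndvd_neq0.
have unit_div (d : int) : (p%:Z %| d)%Z -> ~~ (p%:Z ^+ 2 %| d)%Z ->
    exists2 c, d = c * p%:Z & ~~ (p%:Z %| c)%Z.
  case/dvdzP=> c ->; rewrite expr2 dvdz_mul2r //; by exists c.
have := logn_square_prod p _ _ _ _ pp (nz _ N1) (nz _ N2) (nz _ N3) WE.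
rewrite -!odd_logn_dvdz // /local_unit.
have [D1|D1] := boolP (p%:Z %| d1)%Z; have [D2|D2] := boolP (p%:Z %| d2)%Z;
  have [D3|D3] := boolP (p%:Z %| d3)%Z => //= _; last first.
- apply: (lsol_twisted_unit p _ _ _ _ _ _ W) => //; try by rewrite mulrA dvdz_mull.
    by rewrite -!mulrDl e0 mul0r.
  by rewrite mulrA expr2 dvdz_mul2r // primez_dvdM // (negPf P1).
- have [c2 c2E C2] := unit_div _ D2 N2; have [c3 c3E C3] := unit_div _ D3 N3.
  rewrite c2E c3E !mulzK //; apply: (lsol_twisted_ramified p _ _ _ _ _ _ _ W) => //.
  by rewrite -c2E -c3E.
- have [c1 c1E C1] := unit_div _ D1 N1; have [c3 c3E C3] := unit_div _ D3 N3.
  rewrite c1E c3E !mulzK //.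
  have R := lsol_twisted_ramified p e2 e3 e1 n' d2 c3 c1 W pp podd.
  have -> : lsol p (e1 * (n' * p%:Z)) (e2 * (n' * p%:Z)) (e3 * (n' * p%:Z)) (c1 * p%:Z) d2 (c3 * p%:Z) <->
    lsol p (e2 * (n' * p%:Z)) (e3 * (n' * p%:Z)) (e1 * (n' * p%:Z)) d2 (c3 * p%:Z) (c1 * p%:Z).
    by split=> [/lsol_rot|/lsol_rot/lsol_rot].
  rewrite R //; first by split=> -[].
    by rewrite -e0; ring.
  by rewrite -WE c1E c3E; ring.
have [c1 c1E C1] := unit_div _ D1 N1; have [c2 c2E C2] := unit_div _ D2 N2.
rewrite c1E c2E !mulzK //.
have R := lsol_twisted_ramified p e3 e1 e2 n' d3 c1 c2 W pp podd.
have -> : lsol p (e1 * (n' * p%:Z)) (e2 * (n' * p%:Z)) (e3 * (n' * p%:Z)) (c1 * p%:Z) (c2 * p%:Z) d3 <->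
  lsol p (e3 * (n' * p%:Z)) (e1 * (n' * p%:Z)) (e2 * (n' * p%:Z)) d3 (c1 * p%:Z) (c2 * p%:Z).
  by split=> [/lsol_rot/lsol_rot|/lsol_rot].
rewrite R //; first by split=> -[].
  by rewrite -e0; ring.
by rewrite -WE c1E c2E; ring.
Qed.

(** * The Hilbert symbols in the matrix [A] *)

Lemma hilbert_add_modsol (p : nat) (a b : int) : prime p ->
  hilbert_add p a b = (~~ `[< forall K, exists x y z : int,
    ~~ [&& (p%:Z %| x)%Z, (p%:Z %| y)%Z & (p%:Z %| z)%Z] /\
    ((p ^ K)%:Z %| a * x ^+ 2 + b * y ^+ 2 - z ^+ 2)%Z >])%:R.
Proof.
move=> pp; rewrite /hilbert_add.
set P := padic_solvable _ _; set Q := (X in _ = (~~ `[< X >])%:R).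
suff PQ : P <-> Q.
  have -> : `[< P >] = `[< Q >] by apply/asboolP/asboolP; tauto.
  by case: `[< Q >].
rewrite /P padic_solvableP //.
pose i1 : 'I_3 := lift ord0 ord0.
pose i2 : 'I_3 := lift ord0 (lift ord0 ord0).
have formE (x : 'I_3 -> int) (j : 'I_1) : diag_form (fun i =>
    (\matrix_(j < 1, i < 3) nth 0 [:: a; b; -1] i : 'M[int]_(1, 3)) j i) x =
    a * x ord0 ^+ 2 + b * x i1 ^+ 2 - x i2 ^+ 2.
  by rewrite /diag_form !big_ord_recl big_ord0 !mxE /= -/i1 -/i2 !intz; ring.
split=> sol K; have := sol K.
  case=> x [[i px] fx]; exists (x ord0), (x i1), (x i2).
  split; last by have := fx ord0; rewrite formE.
  apply: contra px => /and3P[p0 p1 p2].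
  case: i => [[|[|[|//]]] lt]; [move: p0|move: p1|move: p2];
    by congr (is_true (_ %| x _)%Z); apply: val_inj.
case=> x [y [z [prim E]]].
exists (fun i : 'I_3 => nth 0 [:: x; y; z] i); split; last by move=> j; rewrite formE.
by move: prim; rewrite !negb_and => /or3P[] P0; [exists ord0|exists i1|exists i2].
Qed.

(** The tame symbol. Modulo [p] the conic reads [a * x ^+ 2 = z ^+ 2], and the precision [p ^ 2] is
    used to see that [x] is a unit. *)
Lemma hilbert_add_unit (p : nat) (n' a : int) : prime p -> odd p ->
  ~~ (p%:Z %| n')%Z -> ~~ (p%:Z %| a)%Z ->
  hilbert_add p a (- (n' * p%:Z)) = (~~ sqb 'F_p a%:~R)%:R.
Proof.
move=> pp podd PN PA; rewrite hilbert_add_modsol //; congr (~~ _)%:R.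
have p0 : p%:Z != 0 by rewrite eqz_nat -lt0n prime_gt0.
apply/asboolP/idP => [sol|sa K]; last first.
  have [s [sE sp]] := lsq_odd p a pp podd PA sa K.
  exists 1, 0, s; split; first by rewrite !negb_and sp !orbT.
  by have := dvdzN _ _ sE; apply: dvdz_eqr; ring.
have [x [y [z [prim E]]]] := sol 2%N.
have E1 : (p%:Z %| a * x ^+ 2 - z ^+ 2)%Z.
  have := dvdz_expn_le p 1 2 _ isT E; rewrite expn1 => E1.
  have := dvdzD _ _ _ E1 (dvdz_mull (n' * y ^+ 2) (dvdzz p%:Z)).
  by apply: dvdz_eqr; ring.
have xz : (p%:Z %| x)%Z = (p%:Z %| z)%Z.
  rewrite -(primez_dvdX2 _ z) // -[RHS](rpredDl _ E1) subrK primez_dvdM // (negPf PA) /=.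
  by rewrite primez_dvdX2.
have px : ~~ (p%:Z %| x)%Z.
  apply: contra prim => px; have pz : (p%:Z %| z)%Z by rewrite -xz.
  rewrite px pz andbT /=; move: E; rewrite -[(p ^ 2)%:Z]/((p * p)%:Z) PoszM => E.
  have : (p%:Z * p%:Z %| n' * y ^+ 2 * p%:Z)%Z.
    have := dvdzB _ _ _ (dvdzB _ _ _ (dvdz_mull a (dvdz_mul px px)) (dvdz_mul pz pz)) E.
    by apply: dvdz_eqr; ring.
  by rewrite dvdz_mul2r // primez_dvdM // (negPf PN) /= primez_dvdX2.
have px2 : ~~ (p%:Z %| x ^+ 2)%Z by rewrite primez_dvdX2.
rewrite -(sqb_mull p (x ^+ 2)) ?sqb_sqr //; apply/(sqb_FpP _ _ pp); exists z.
by have := dvdzN _ _ E1; apply: dvdz_eqr; ring.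
Qed.

(** The symbol of [p] and [-p] is trivial, so this is the symbol of [p] and [n']: a diagonal entry
    of [A] is the class of the cofactor [n']. *)
Lemma hilbert_add_self (p : nat) (n' : int) : prime p -> odd p ->
  ~~ (p%:Z %| n')%Z ->
  hilbert_add p p%:Z (- (n' * p%:Z)) = (~~ sqb 'F_p n'%:~R)%:R.
Proof.
move=> pp podd PN; rewrite hilbert_add_modsol //; congr (~~ _)%:R.
have p0 : p%:Z != 0 by rewrite eqz_nat -lt0n prime_gt0.
apply/asboolP/idP => [sol|sa K]; last first.
  have [s [sE sp]] := lsq_odd p n' pp podd PN sa K.
  exists s, 1, 0; split; first by rewrite !negb_and sp.
  by have := dvdz_mull p%:Z sE; apply: dvdz_eqr; ring.
have [x [y [z [prim E]]]] := sol 2%N.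
have pz : (p%:Z %| z)%Z.
  have := dvdz_expn_le p 1 2 _ isT E; rewrite expn1 => E1.
  rewrite -primez_dvdX2 //.
  have := dvdzB _ _ _ (dvdz_mull (x ^+ 2 - n' * y ^+ 2) (dvdzz p%:Z)) E1.
  by apply: dvdz_eqr; ring.
have E1 : (p%:Z %| x ^+ 2 - n' * y ^+ 2)%Z.
  rewrite -(dvdz_mul2r p0); move: E; rewrite -[(p ^ 2)%:Z]/((p * p)%:Z) PoszM => E.
  have := dvdzD _ _ _ E (dvdz_mul pz pz).
  by apply: dvdz_eqr; ring.
have py : ~~ (p%:Z %| y)%Z.
  apply: contra prim => py; rewrite py pz !andbT -primez_dvdX2 //.
  have := dvdzD _ _ _ E1 (dvdz_mull (n' * y) py).
  by apply: dvdz_eqr; ring.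
have py2 : ~~ (p%:Z %| y ^+ 2)%Z by rewrite primez_dvdX2.
rewrite -(sqb_mull p (y ^+ 2)) ?sqb_sqr //; apply/(sqb_FpP _ _ pp); exists x.
by move: E1; apply: dvdz_eqr; ring.
Qed.

(** * Torsion triples and the Selmer group of E *)

Lemma is_squareM (a b : int) : is_square a -> is_square b -> is_square (a * b).
Proof. by move=> [u ->] [v ->]; exists (u * v); ring. Qed.

Lemma is_square_cancel (a b : int) : a != 0 -> is_square (a ^+ 2 * b) -> is_square b.
Proof.
move=> a0 [w wE]; have /dvdzP[v vE] : (a %| w)%Z.
  by rewrite -(dvdz_pexp2r _ _ (isT : (0 < 2)%N)) [w ^+ 2]expr2 -wE dvdz_mulr.
exists v; apply: (mulfI (expf_neq0 2 a0)); rewrite wE vE; ring.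
Qed.

Lemma is_square_trans (b a c : int) :
  b != 0 -> is_square (a * b) -> is_square (b * c) -> is_square (a * c).
Proof.
move=> b0 ab bc; apply: (is_square_cancel b) => //.
have -> : b ^+ 2 * (a * c) = a * b * (b * c) by ring.
exact: is_squareM.
Qed.

(** The square root of [y] is its gcd with [w]. *)
Lemma coprime_square_nat (x y w : nat) :
  (0 < y)%N -> coprime x y -> (x * y = w * w)%N -> exists g, y = (g * g)%N.
Proof.
move=> y0 cxy xyE; set g := gcdn y w.
have g0 : (0 < g)%N by rewrite gcdn_gt0 y0.
have [[y' yE] [w' wE]] := (dvdnP (dvdn_gcdl y w), dvdnP (dvdn_gcdr y w)).
rewrite -/g in yE wE.
have cyw : coprime y' w'.
  by rewrite /coprime -(eqn_pmul2r g0) muln_gcdl -yE -wE mul1n.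
have E : (x * y' = g * (w' * w'))%N.
  apply/eqP; rewrite -(eqn_pmul2r g0) -mulnA -yE xyE wE; apply/eqP; ring.
exists g; rewrite {1}yE; congr muln; apply/eqP; rewrite eqn_dvd; apply/andP; split.
  have cyww : coprime y' (w' * w') by rewrite coprimeMr cyw.
  by rewrite -(Gauss_dvdl g cyww) -E dvdn_mull.
have cgx : coprime g x.
  by apply: (coprime_dvdl (dvdn_gcdl y w)); rewrite coprime_sym.
by rewrite -(Gauss_dvdr y' cgx) E dvdn_mulr.
Qed.

Lemma coprime_square (x y : int) :
  0 < x -> coprime `|x| `|y| -> is_square (x * y) -> is_square y.
Proof.
move=> x0 cxy [w wE]; have [->|y0] := eqVneq y 0; first by exists 0.
have yp : 0 < y.
  by rewrite lt_neqAle eq_sym y0 /= -(pmulr_rge0 _ x0) wE -expr2 sqr_ge0.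
have [||g gE] := coprime_square_nat `|x| `|y| `|w| _ cxy.
- by rewrite absz_gt0.
- by rewrite -!abszM wE.
by exists g%:Z; rewrite -(gtz0_abs yp) gE PoszM.
Qed.

(** Halving a 2-torsion point: if [r] minus each of the other two roots of the cubic is [a ^+ 2],
    respectively [b ^+ 2], then the point with coordinates [r + a * b] and [a * b * (a + b)] doubles
    to [(r, 0)]. *)
Lemma order4_point (e1 e2 r a b : int) :
  a != 0 -> b != 0 ->
  [\/ r = e1 /\ e1 = a * a /\ e1 + e2 = b * b,
      r = 0 /\ - e1 = a * a /\ e2 = b * b |
      r = - e2 /\ - e2 = a * a /\ - e2 - e1 = b * b] ->
  has_rat_point_of_order4 e1 e2 1.
Proof.
move=> a0 b0 cases.
(* Positive roots are chosen so that their sum, and with it the ordinate of the point, is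
   nonzero. *)
have [a' a'0 a'E] : exists2 a', 0 < a' & a * a = a' * a' :> int.
  by exists `|a|; rewrite ?normr_gt0 // -!expr2 real_normK ?num_real.
have [b' b'0 b'E] : exists2 b', 0 < b' & b * b = b' * b' :> int.
  by exists `|b|; rewrite ?normr_gt0 // -!expr2 real_normK ?num_real.
rewrite a'E b'E in cases; clear a b a0 b0 a'E b'E.
pose A : rat := a'%:~R; pose B : rat := b'%:~R.
have A0 : 0 < A by rewrite ltr0z.
have B0 : 0 < B by rewrite ltr0z.
have AB : A + B != 0 by rewrite gt_eqF // addr_gt0.
exists (r%:~R + A * B), (A * B * (A + B)); split.
- case: cases => -[-> [Ea Eb]].
  + have -> : e2 = b' * b' - e1 by rewrite -Eb; ring.
    by rewrite Ea !(rmorphD, rmorphB, rmorphM, rmorphN, rmorphXn) /= -/A -/B; ring.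
  + have -> : e1 = - (a' * a') by rewrite -Ea opprK.
    by rewrite Eb !(rmorphD, rmorphB, rmorphM, rmorphN, rmorphXn) /= -/A -/B; ring.
  + have -> : e1 = a' * a' - b' * b' by rewrite -Ea -Eb; ring.
    have -> : e2 = - (a' * a') by rewrite -Ea opprK.
    by rewrite !(rmorphD, rmorphB, rmorphM, rmorphN, rmorphXn) /= -/A -/B; ring.
- by rewrite !mulf_neq0 // gt_eqF.
- case: cases => -[-> [Ea Eb]].
  + have -> : e2 = b' * b' - e1 by rewrite -Eb; ring.
    rewrite Ea !(rmorphD, rmorphB, rmorphM, rmorphN, rmorphXn) /= -/A -/B.
    field; by rewrite AB ?gt_eqF.
  + have -> : e1 = - (a' * a') by rewrite -Ea opprK.
    rewrite Eb !(rmorphD, rmorphB, rmorphM, rmorphN, rmorphXn) /= -/A -/B.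
    field; by rewrite AB ?gt_eqF.
  + have -> : e1 = a' * a' - b' * b' by rewrite -Ea -Eb; ring.
    have -> : e2 = - (a' * a') by rewrite -Ea opprK.
    rewrite !(rmorphD, rmorphB, rmorphM, rmorphN, rmorphXn) /= -/A -/B.
    field; by rewrite AB ?gt_eqF.
Qed.

Lemma is_square_neq0 (x : int) : x != 0 -> is_square x -> exists2 w, w != 0 & x = w * w.
Proof.
by move=> x0 [w wE]; exists w => //; apply: contraNneq x0 => w0; rewrite wE w0 mulr0.
Qed.

(** In each line the two squares would make a nontrivial torsion triple trivial, so the
    corresponding 2-torsion point would be the double of a point of order 4. *)
Lemma no_order4_squares (e1 e2 e3 : int) :
  e1 != 0 -> e2 != 0 -> e3 != 0 -> e1 + e2 + e3 = 0 ->
  ~ has_rat_point_of_order4 e1 e2 1 ->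
  [/\ is_square (- e3) -> is_square e1 -> False,
      is_square e3 -> is_square (- e2) -> False &
      is_square e2 -> is_square (- e1) -> False].
Proof.
move=> E1 E2 E3 e0 no4.
have e3E : e3 = - (e1 + e2) by apply/eqP; rewrite -subr_eq0 -e0; apply/eqP; ring.
split=> /is_square_neq0-/(_ ltac:(by rewrite ?oppr_eq0))[b b0 bE]
  /is_square_neq0-/(_ ltac:(by rewrite ?oppr_eq0))[a a0 aE]; apply: no4.
- by apply: (order4_point _ _ e1 a b) => //; constructor 1; rewrite -bE e3E opprK.
- by apply: (order4_point _ _ (- e2) a b) => //; constructor 3; rewrite -bE -aE e3E; do !split; ring.
- by apply: (order4_point _ _ 0 a b) => //; constructor 2.
Qed.

(** Modulo squares the product of two nontrivial torsion triples is the third, so every coincidence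
    makes some nontrivial triple trivial. *)
Lemma torsion_separated (e1 e2 e3 : int) (c c' : nat) :
  e1 != 0 -> e2 != 0 -> e3 != 0 -> e1 + e2 + e3 = 0 ->
  ~ has_rat_point_of_order4 e1 e2 1 -> (c < 4)%N -> (c' < 4)%N ->
  sq_equiv (nth (1, 1, 1) (torsion_triples e1 e2 e3 1) c)
           (nth (1, 1, 1) (torsion_triples e1 e2 e3 1) c') -> c = c'.
Proof.
move=> E1 E2 E3 e0 no4.
have [N1 N2 N3] := no_order4_squares _ _ _ E1 E2 E3 e0 no4.
have sqE (x a y : int) : a != 0 -> is_square x -> x = a ^+ 2 * y -> is_square y.
  by move=> a0 sx xE; apply: (is_square_cancel a) => //; rewrite -xE.
wlog cc' : c c' / (c <= c')%N => [H c4 c4'|].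
  have [le|/ltnW le] := leqP c c'; first exact: H.
  move=> [S1 S2 S3]; apply/esym/(H c' c le c4' c4); split; by rewrite mulrC.
move: c c' cc' => [|[|[|[|//]]]] [|[|[|[|//]]]] //= _ _ _ [] /=;
  rewrite /t1 /t2 /t3 /= ?mulr1 ?mul1r => S1 S2 S3; exfalso.
- exact: N1.
- exact: N2.
- exact: N3.
- by apply: N3; [apply: (sqE _ e3 _ E3 S1); ring | apply: (sqE _ e3 _ E3 S2); ring].
- by apply: N2; [apply: (sqE _ e1 _ E1 S2); ring | apply: (sqE _ e1 _ E1 S3); ring].
- by apply: N1; [apply: (sqE _ e2 _ E2 S1); ring | apply: (sqE _ e2 _ E2 S3); ring].
Qed.

(** * Real points, and the torsion triples as Selmer elements *)

Lemma real_solvable_D (e1 e2 e3 m d1 d2 d3 : int) (t u1 u2 u3 : Rdefinitions.R) :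
  ~~ [&& t == 0, u1 == 0, u2 == 0 & u3 == 0] ->
  (e1 * m)%:~R * t ^+ 2 + d2%:~R * u2 ^+ 2 - d3%:~R * u3 ^+ 2 = 0 ->
  (e2 * m)%:~R * t ^+ 2 + d3%:~R * u3 ^+ 2 - d1%:~R * u1 ^+ 2 = 0 ->
  (e3 * m)%:~R * t ^+ 2 + d1%:~R * u1 ^+ 2 - d2%:~R * u2 ^+ 2 = 0 ->
  real_solvable (D_coef e1 e2 e3 m d1 d2 d3).
Proof.
move=> nz E1 E2 E3.
exists (fun i : 'I_4 => nth 0 [:: t; u1; u2; u3] i); split.
  pose i1 : 'I_4 := lift ord0 ord0.
  pose i2 : 'I_4 := lift ord0 (lift ord0 ord0).
  pose i3 : 'I_4 := lift ord0 (lift ord0 (lift ord0 ord0)).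
  by move: nz; rewrite !negb_and => /or4P[] P; [exists ord0|exists i1|exists i2|exists i3].
move=> j; rewrite /diag_form !big_ord_recl big_ord0 !mxE /=.
by case: j => [[|[|[|//]]]] /= _; [rewrite -[RHS]E1|rewrite -[RHS]E2|rewrite -[RHS]E3];
  rewrite ?rmorphN /=; ring.
Qed.

Lemma real_solvable_DP (e1 e2 e3 m d1 d2 d3 : int) :
  real_solvable (D_coef e1 e2 e3 m d1 d2 d3) ->
  exists t u1 u2 u3 : Rdefinitions.R,
  [/\ ~~ [&& t == 0, u1 == 0, u2 == 0 & u3 == 0],
  (e1 * m)%:~R * t ^+ 2 + d2%:~R * u2 ^+ 2 - d3%:~R * u3 ^+ 2 = 0,
  (e2 * m)%:~R * t ^+ 2 + d3%:~R * u3 ^+ 2 - d1%:~R * u1 ^+ 2 = 0 &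
  (e3 * m)%:~R * t ^+ 2 + d1%:~R * u1 ^+ 2 - d2%:~R * u2 ^+ 2 = 0].
Proof.
move=> [x [[i xi] fx]].
pose i1 : 'I_4 := lift ord0 ord0.
pose i2 : 'I_4 := lift ord0 (lift ord0 ord0).
pose i3 : 'I_4 := lift ord0 (lift ord0 (lift ord0 ord0)).
exists (x ord0), (x i1), (x i2), (x i3); split.
- apply: contra xi => /and4P[p0 p1 p2 p3].
  case: i => [[|[|[|[|//]]]] lt]; [move: p0|move: p1|move: p2|move: p3];
    by congr (is_true (x _ == 0)); apply: val_inj.
- have := fx ord0; rewrite /diag_form !big_ord_recl big_ord0 !mxE /= -/i1 -/i2 -/i3 => <-.
  by rewrite ?rmorphN /=; ring.
- have := fx (lift ord0 ord0); rewrite /diag_form !big_ord_recl big_ord0 !mxE /= -/i1 -/i2 -/i3 => <-.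
  by rewrite ?rmorphN /=; ring.
- have := fx (lift ord0 (lift ord0 ord0)).
  rewrite /diag_form !big_ord_recl big_ord0 !mxE /= -/i1 -/i2 -/i3 => <-.
  by rewrite ?rmorphN /=; ring.
Qed.

Lemma adelic_of_point (e1 e2 e3 d1 d2 d3 u1 u2 u3 : int) :
  e1 + d2 * u2 ^+ 2 - d3 * u3 ^+ 2 = 0 ->
  e2 + d3 * u3 ^+ 2 - d1 * u1 ^+ 2 = 0 ->
  e3 + d1 * u1 ^+ 2 - d2 * u2 ^+ 2 = 0 ->
  adelic_solvable (D_coef e1 e2 e3 1 d1 d2 d3).
Proof.
move=> E1 E2 E3; split=> [|p pp].
  apply: (real_solvable_D _ _ _ _ _ _ _ 1 u1%:~R u2%:~R u3%:~R).
  - by rewrite oner_eq0.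
  - by rewrite expr1n !mulr1 -!rmorphXn -!rmorphM -rmorphD -rmorphB /= E1.
  - by rewrite expr1n !mulr1 -!rmorphXn -!rmorphM -rmorphD -rmorphB /= E2.
  - by rewrite expr1n !mulr1 -!rmorphXn -!rmorphM -rmorphD -rmorphB /= E3.
apply/padic_lsol => // K; exists 1, u1, u2, u3; split.
  by split; rewrite expr1n !mulr1 ?E1 ?E2 ?E3 dvdz0.
by rewrite /alldvd dvdz1 /= negb_and neq_ltn prime_gt1 // orbT.
Qed.

(** Each triple has a global point: [t = 0] for the trivial one, otherwise [t = 1] with one [u_i]
    equal to 0 and the other two equal to 1. *)
Lemma torsion_inSel (e1 e2 e3 : int) (T : triple) :
  e1 != 0 -> e2 != 0 -> e3 != 0 -> e1 + e2 + e3 = 0 ->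
  T \in torsion_triples e1 e2 e3 1 -> inSel e1 e2 e3 1 T.
Proof.
move=> E1 E2 E3 e0.
have e3E : e3 = - (e1 + e2) by apply/eqP; rewrite -subr_eq0 -e0; apply/eqP; ring.
rewrite !inE => /or4P[] /eqP ->; split; rewrite /t1 /t2 /t3 /= ?mulr1 ?oppr_eq0 ?mulf_neq0 //.
- by exists 1.
- split=> [|p pp].
    apply: (real_solvable_D _ _ _ _ _ _ _ 0 1 1 1); rewrite ?eqxx ?oner_eq0 //;
      by rewrite expr0n expr1n /= mulr0 add0r subrr.
  by apply/padic_lsol => //; apply: lsol_lsq; rewrite ?mulr1 //; apply: lsq1.
- by exists (e1 * e3); ring.
- by apply: (adelic_of_point _ _ _ _ _ _ 1 0 1); rewrite ?e3E; ring.
- by exists (e2 * e3); ring.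
- by apply: (adelic_of_point _ _ _ _ _ _ 0 1 1); rewrite ?e3E; ring.
- by exists (e1 * e2); ring.
- by apply: (adelic_of_point _ _ _ _ _ _ 1 1 0); rewrite ?e3E; ring.
Qed.

Lemma sq_equiv_sym (L L' : triple) : sq_equiv L L' -> sq_equiv L' L.
Proof. by move=> [S1 S2 S3]; split; rewrite mulrC. Qed.

Lemma sq_equiv_trans (L L' L'' : triple) :
  t1 L' != 0 -> t2 L' != 0 -> t3 L' != 0 ->
  sq_equiv L L' -> sq_equiv L' L'' -> sq_equiv L L''.
Proof.
move=> n1 n2 n3 [S1 S2 S3] [R1 R2 R3].
by split; [apply: (is_square_trans (t1 L')) | apply: (is_square_trans (t2 L'))
  | apply: (is_square_trans (t3 L'))].
Qed.

(** The four torsion triples map injectively to the four classes listed by [s], hence bijectively,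
    so every Selmer class is a torsion one. *)
Lemma inSel_torsion (e1 e2 e3 : int) (s : seq triple) :
  e1 != 0 -> e2 != 0 -> e3 != 0 -> e1 + e2 + e3 = 0 ->
  ~ has_rat_point_of_order4 e1 e2 1 ->
  size s = 4%N ->
  (forall L, L \in s -> inSel e1 e2 e3 1 L) ->
  (forall L, inSel e1 e2 e3 1 L -> exists2 L', L' \in s & sq_equiv L L') ->
  forall L, inSel e1 e2 e3 1 L ->
  exists2 c, (c < 4)%N & sq_equiv L (nth (1, 1, 1) (torsion_triples e1 e2 e3 1) c).
Proof.
move=> E1 E2 E3 e0 no4 s4 sSel cover L LSel.
set T := torsion_triples e1 e2 e3 1.
have /choice[f fP] : forall c : 'I_4, exists b : 'I_4,
    sq_equiv (nth (1, 1, 1) T c) (nth (1, 1, 1) s b).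
  move=> c; have cT : nth (1, 1, 1) T c \in T by rewrite mem_nth.
  have [L' L's] := cover _ (torsion_inSel _ _ _ _ E1 E2 E3 e0 cT).
  have bP : (index L' s < 4)%N by rewrite -s4 index_mem.
  by exists (Ordinal bP); rewrite /= nth_index.
have nz (b : 'I_4) : inSel e1 e2 e3 1 (nth (1, 1, 1) s b).
  by apply: sSel; rewrite mem_nth // s4.
have fI : injective f.
  move=> c c' ff; apply: val_inj; apply: (torsion_separated e1 e2 e3 _ _ E1 E2 E3 e0 no4
    (ltn_ord c) (ltn_ord c')).
  have := fP c; have := fP c'; rewrite -ff => S' S.
  have [n1 n2 n3 _ _] := nz (f c).
  exact: sq_equiv_trans _ _ _ n1 n2 n3 S (sq_equiv_sym _ _ S').
have [L' L's LL'] := cover _ LSel.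
have bP : (index L' s < 4)%N by rewrite -s4 index_mem.
have [g gK fK] := injF_bij fI.
exists (g (Ordinal bP)) => //.
have := fP (g (Ordinal bP)); rewrite fK /= nth_index // => S.
have [n1 n2 n3 _ _] := sSel _ L's.
exact: sq_equiv_trans _ _ _ n1 n2 n3 LL' (sq_equiv_sym _ _ S).
Qed.

(** * Divisors of n and the twist *)

(** A divisor of the square-free [n] is encoded by its set of prime factors, so that multiplication
    modulo squares becomes addition of bits modulo 2. *)
Definition dprod (k : nat) (p : 'I_k -> nat) (b : 'I_k -> bool) : nat :=
  (\prod_(j < k) p j ^ b j)%N.

Lemma dprod_gt0 (k : nat) (p : 'I_k -> nat) (b : 'I_k -> bool) :
  (forall i, prime (p i)) -> (0 < dprod k p b)%N.
Proof. by move=> pp; rewrite prodn_gt0 // => j; rewrite expn_gt0 prime_gt0. Qed.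

Lemma logn_dprod_sum (k : nat) (p : 'I_k -> nat) (b : 'I_k -> bool) (q : nat) :
  (forall i, prime (p i)) ->
  logn q (dprod k p b) = (\sum_(j < k) b j * (q == p j))%N.
Proof.
move=> pp; suff [] : (0 < dprod k p b)%N /\
  logn q (dprod k p b) = (\sum_(j < k) b j * (q == p j))%N by [].
rewrite /dprod; elim/big_rec2: _ => [|j s m _ [m0 <-]]; first by rewrite logn1.
have pj : (0 < p j ^ b j)%N by rewrite expn_gt0 prime_gt0.
by rewrite muln_gt0 pj m0 lognM // lognX logn_prime.
Qed.

Lemma logn_dprod (k : nat) (p : 'I_k -> nat) (b : 'I_k -> bool) (i : 'I_k) :
  injective p -> (forall i, prime (p i)) -> logn (p i) (dprod k p b) = b i.
Proof.
move=> pI pp; rewrite logn_dprod_sum // (bigD1 i) //= eqxx muln1 big1 ?addn0 //.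
by move=> j ji; rewrite (inj_eq pI) eq_sym (negPf ji) muln0.
Qed.

Lemma logn_dprod0 (k : nat) (p : 'I_k -> nat) (b : 'I_k -> bool) (q : nat) :
  (forall i, prime (p i)) -> (forall i, q != p i) -> logn q (dprod k p b) = 0%N.
Proof.
by move=> pp qp; rewrite logn_dprod_sum // big1 // => j _; rewrite (negPf (qp j)) muln0.
Qed.

Lemma dprod_dvd (k : nat) (p : 'I_k -> nat) (b : 'I_k -> bool) (n : nat) :
  n = (\prod_(i < k) p i)%N -> (dprod k p b %| n)%N.
Proof.
move=> ->; rewrite /dprod; elim/big_rec2: _ => // j x y _ xy; apply: dvdn_mul => //.
by case: (b j); rewrite ?expn1 // expn0 dvd1n.
Qed.

Lemma dprod_true (k : nat) (p : 'I_k -> nat) (n : nat) :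
  n = (\prod_(i < k) p i)%N -> n = dprod k p xpredT.
Proof. by move=> ->; apply: eq_bigr => i _; rewrite expn1. Qed.

Lemma divisor_dprod (k : nat) (p : 'I_k -> nat) (n d : nat) :
  injective p -> (forall i, prime (p i)) -> n = (\prod_(i < k) p i)%N ->
  (d %| n)%N -> d = dprod k p (fun j => odd (logn (p j) d)).
Proof.
move=> pI pp nE dn.
have n0 : (0 < n)%N by rewrite (dprod_true _ _ _ nE) dprod_gt0.
have d0 := dvdn_gt0 n0 dn.
apply: eqn_from_log => //; first exact: dprod_gt0.
move=> q; have := dvdn_leq_log q n0 dn; rewrite {1}(dprod_true _ _ _ nE).
have [/existsP[i /eqP ->]|/existsPn nq] := boolP [exists i, q == p i].
  by rewrite !logn_dprod //; case: (logn (p i) d) => [|[|]].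
by rewrite !logn_dprod0 // leqn0 => /eqP.
Qed.

Lemma dprod_square3 (k : nat) (p : 'I_k -> nat) (b1 b2 b3 : 'I_k -> bool) :
  (forall j, b1 j (+) b2 j (+) b3 j = false) ->
  exists W : int, (dprod k p b1)%:Z * (dprod k p b2)%:Z * (dprod k p b3)%:Z = W * W.
Proof.
move=> bx; exists (\prod_(j < k) p j ^ (b1 j || b2 j))%N%:Z.
rewrite -!PoszM -!big_split /=; congr Posz; apply: eq_bigr => j _.
move: (bx j); case: (b1 j); case: (b2 j); case: (b3 j) => //=; rewrite ?expn1 ?expn0 //= ?muln1 ?mul1n //.
Qed.

Record twist_data (e1 e2 e3 : int) (k : nat) (p : 'I_k -> nat) (n : nat) : Prop := TwistData {
  td_e1 : e1 != 0; td_e2 : e2 != 0; td_e3 : e3 != 0;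
  td_sum : e1 + e2 + e3 = 0;
  td_inj : injective p; td_prime : forall i, prime (p i);
  td_prod : n = (\prod_(i < k) p i)%N;
  td_coprime : coprime n `|e1 * e2 * e3|;
  td_residue : forall i (q : nat), prime q -> odd q -> (q %| absz (e1 * e2 * e3)%R)%N ->
     exists x : nat, (x ^ 2 == p i %[mod q])%N;
  td_mod8 : forall i, (p i %% 8 = 1)%N }.

Lemma td_odd (e1 e2 e3 : int) (k : nat) (p : 'I_k -> nat) (n : nat) (i : 'I_k) :
  twist_data e1 e2 e3 k p n -> odd (p i).
Proof. by move=> D; have := td_mod8 _ _ _ _ _ _ D i; clear; lia. Qed.

Lemma td_dvd (e1 e2 e3 : int) (k : nat) (p : 'I_k -> nat) (n : nat) (i : 'I_k) :
  twist_data e1 e2 e3 k p n -> (p i %| n)%N.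
Proof. by move=> D; rewrite (td_prod _ _ _ _ _ _ D) (bigD1 i) //= dvdn_mulr. Qed.

Lemma td_ndvd (e1 e2 e3 : int) (k : nat) (p : 'I_k -> nat) (n : nat) (i : 'I_k) :
  twist_data e1 e2 e3 k p n -> ~~ ((p i)%:Z %| e1 * e2 * e3)%Z.
Proof.
move=> D; have pp := td_prime _ _ _ _ _ _ D i.
rewrite dvdzE -prime_coprime //; apply: coprime_dvdl (td_coprime _ _ _ _ _ _ D).
exact: td_dvd D.
Qed.

Lemma td_square (e1 e2 e3 : int) (k : nat) (p : 'I_k -> nat) (n : nat) (i : 'I_k) :
  twist_data e1 e2 e3 k p n ->
  [/\ sqb 'F_(p i) (-1)%:~R, sqb 'F_(p i) e1%:~R, sqb 'F_(p i) e2%:~R &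
      sqb 'F_(p i) e3%:~R].
Proof.
move=> D; have pp := td_prime _ _ _ _ _ _ D i; have p8 := td_mod8 _ _ _ _ _ _ D i.
have N := td_ndvd _ _ _ _ _ _ i D.
have sub (e : int) : e != 0 -> (e %| e1 * e2 * e3)%Z -> sqb 'F_(p i) e%:~R.
  move=> e0 ed; apply: int_residue_square => //.
    by apply: contra N => pe; apply: dvdz_trans ed; rewrite dvdzE.
  move=> q qp qo qe; apply: (td_residue _ _ _ _ _ _ D i q qp qo).
  exact: dvdn_trans qe _.
split.
- apply: int_residue_square => //; first by rewrite dvdn1 neq_ltn prime_gt1 ?orbT.
  by move=> q qp _; rewrite dvdn1 => /eqP q1; move: qp; rewrite q1.
- by apply: sub; [exact: td_e1 D | rewrite -mulrA dvdz_mulr].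
- by apply: sub; [exact: td_e2 D | rewrite mulrAC dvdz_mull].
- by apply: sub; [exact: td_e3 D | rewrite dvdz_mull].
Qed.

Lemma td_lsq (e1 e2 e3 : int) (k : nat) (p : 'I_k -> nat) (n q : nat) (b : 'I_k -> bool) :
  twist_data e1 e2 e3 k p n -> prime q ->
  q = 2%N \/ (q%:Z %| e1 * e2 * e3)%Z -> lsq q (dprod k p b)%:Z.
Proof.
move=> D qp bad.
have lp j : lsq q (p j)%:Z.
  have [q2|qodd] := even_prime qp.
    rewrite q2; apply: lsq_two; have := td_mod8 _ _ _ _ _ _ D j; clear; lia.
  case: bad => [q2|qe]; first by rewrite q2 in qodd.
  have N := td_ndvd _ _ _ _ _ _ j D; have pp := td_prime _ _ _ _ _ _ D j.
  apply: lsq_odd => //.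
    rewrite dvdzE /= dvdn_prime2 //; apply: contra N => /eqP <-.
    exact: qe.
  have [x xE] := td_residue _ _ _ _ _ _ D j q qp qodd qe.
  apply/(sqb_FpP _ _ qp); exists x%:Z.
  by rewrite -eqz_mod_dvd -posz_expn !modz_nat eqz_nat.
rewrite /dprod; elim/big_ind: _ => [|x y lx ly|j _]; first exact: lsq1.
  by rewrite PoszM; apply: lsq_mul.
by case: (b j); rewrite ?expn1 // expn0; apply: lsq1.
Qed.

(** * The Selmer conditions place by place *)

Lemma real_solvable_pos (e1 e2 e3 m d1 d2 d3 : int) :
  0 < d1 -> 0 < d2 -> 0 < d3 -> real_solvable (D_coef e1 e2 e3 m d1 d2 d3).
Proof.
move=> D1 D2 D3.
pose R := Rdefinitions.R.
have sq (d : int) : 0 < d -> exists2 s : R, s != 0 & d%:~R * s ^+ 2 = 1.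
  move=> d0; have d0R : 0 < d%:~R :> R by rewrite ltr0z.
  exists (Num.sqrt (d%:~R^-1)); first by rewrite gt_eqF // sqrtr_gt0 invr_gt0.
  by rewrite sqr_sqrtr ?divff ?gt_eqF // invr_ge0 ltW.
have [[s1 Z1 E1] [s2 Z2 E2] [s3 Z3 E3]] := And3 (sq _ D1) (sq _ D2) (sq _ D3).
apply: (real_solvable_D _ _ _ _ _ _ _ 0 s1 s2 s3); first by rewrite (negPf Z1) andbF.
all: by rewrite ?E1 ?E2 ?E3 expr0n /= mulr0 add0r subrr.
Qed.

Lemma real_solvable_untwist (e1 e2 e3 m d1 d2 d3 x1 x2 x3 : int) :
  0 < m -> 0 < x1 -> 0 < x2 -> 0 < x3 ->
  real_solvable (D_coef e1 e2 e3 m d1 d2 d3) ->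
  real_solvable (D_coef e1 e2 e3 1 (d1 * x1) (d2 * x2) (d3 * x3)).
Proof.
move=> m0 X1 X2 X3 /real_solvable_DP[t [u1 [u2 [u3 [nz E1 E2 E3]]]]].
pose R := Rdefinitions.R.
have sq (d : int) : 0 < d -> exists2 s : R, s != 0 & s ^+ 2 = d%:~R.
  move=> d0; have d0R : 0 < d%:~R :> R by rewrite ltr0z.
  exists (Num.sqrt d%:~R); first by rewrite gt_eqF // sqrtr_gt0.
  by rewrite sqr_sqrtr // ltW.
have isq (d : int) : 0 < d -> exists2 s : R, s != 0 & d%:~R * s ^+ 2 = 1.
  move=> /sq[s s0 sE]; exists s^-1; rewrite ?invr_eq0 //.
  by rewrite -sE exprVn divff // expf_neq0.
have [s0 Z0 S0] := sq _ m0.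
have [[s1 Z1 S1] [s2 Z2 S2] [s3 Z3 S3]] := And3 (isq _ X1) (isq _ X2) (isq _ X3).
have red (d x : int) (s u : R) : x%:~R * s ^+ 2 = 1 -> (d * x)%:~R * (s * u) ^+ 2 = d%:~R * u ^+ 2.
  move=> E; transitivity (d%:~R * u ^+ 2 * (x%:~R * s ^+ 2)); last by rewrite E mulr1.
  by rewrite intrM; ring.
have red0 (e : int) : (e * 1)%:~R * (s0 * t) ^+ 2 = (e * m)%:~R * t ^+ 2 :> R.
  by rewrite exprMn S0 mulr1 intrM mulrA.
apply: (real_solvable_D _ _ _ _ _ _ _ (s0 * t) (s1 * u1) (s2 * u2) (s3 * u3)).
- by rewrite !mulf_eq0 (negPf Z0) (negPf Z1) (negPf Z2) (negPf Z3).
- by rewrite red0 !red.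
- by rewrite red0 !red.
- by rewrite red0 !red.
Qed.

Lemma ndvd_e (q : nat) (e1 e2 e3 : int) : prime q -> ~~ (q%:Z %| e1 * e2 * e3)%Z ->
  [/\ ~~ (q%:Z %| e1)%Z, ~~ (q%:Z %| e2)%Z & ~~ (q%:Z %| e3)%Z].
Proof.
by move=> qp; rewrite !primez_dvdM // !negb_or => /andP[/andP[-> ->] ->].
Qed.

Lemma dprod_ndvd (k : nat) (p : 'I_k -> nat) (b : 'I_k -> bool) (q : nat) :
  (forall i, prime (p i)) -> prime q -> (forall i, q != p i) ->
  ~~ (q%:Z %| (dprod k p b)%:Z)%Z.
Proof.
move=> pp qp qN; rewrite dvdzE /= -[q in (q %| _)%N]expn1 pfactor_dvdn ?dprod_gt0 //.
by rewrite logn_dprod0.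
Qed.

Lemma dprod_neq0 (k : nat) (p : 'I_k -> nat) (b : 'I_k -> bool) :
  (forall i, prime (p i)) -> (dprod k p b)%:Z != 0.
Proof. by move=> pp; rewrite eqz_nat -lt0n dprod_gt0. Qed.

(** The other places impose nothing: real points come from positivity, at 2 and the primes dividing
    [e1 * e2 * e3] the divisors are unit squares, and elsewhere all coefficients are units. *)
Lemma inSel_divisors (e1 e2 e3 : int) (k : nat) (p : 'I_k -> nat) (n : nat)
    (b1 b2 b3 : 'I_k -> bool) :
  twist_data e1 e2 e3 k p n -> (forall j, b1 j (+) b2 j (+) b3 j = false) ->
  (forall i, lsol (p i) (e1 * n%:Z) (e2 * n%:Z) (e3 * n%:Z)
    (dprod k p b1)%:Z (dprod k p b2)%:Z (dprod k p b3)%:Z) ->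
  inSel e1 e2 e3 n%:Z
    ((dprod k p b1)%:Z, (dprod k p b2)%:Z, (dprod k p b3)%:Z).
Proof.
move=> D bx sol; have pp := td_prime _ _ _ _ _ _ D.
have [W WE] := dprod_square3 k p b1 b2 b3 bx.
have nE := dprod_true _ _ _ (td_prod _ _ _ _ _ _ D).
split; rewrite /t1 /t2 /t3 /= ?dprod_neq0 //; first by exists W.
split; first by apply: real_solvable_pos; rewrite ltz_nat dprod_gt0.
move=> q qp; apply/padic_lsol => //.
have [/existsP[i /eqP ->] //|/existsPn nq] := boolP [exists i, q == p i].
have f0 : e1 * n%:Z + e2 * n%:Z + e3 * n%:Z = 0.
  by rewrite -!mulrDl (td_sum _ _ _ _ _ _ D) mul0r.
have [bad|good] := boolP ((q == 2%N) || (q%:Z %| e1 * e2 * e3)%Z).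
  have bad' : q = 2%N \/ (q%:Z %| e1 * e2 * e3)%Z by case/orP: bad => [/eqP|]; [left|right].
  by apply: lsol_lsq => //; apply: td_lsq D qp bad'.
move: good; rewrite negb_or => /andP[q2 qe].
have qodd : odd q by case: (even_prime qp) q2 => [->|].
have [P1 P2 P3] := ndvd_e _ _ _ _ qp qe.
have qn : ~~ (q%:Z %| n%:Z)%Z by rewrite nE dprod_ndvd.
by apply: (lsol_good _ _ _ _ _ _ _ W) => //; rewrite ?dprod_ndvd // primez_dvdM // negb_or;
  apply/andP.
Qed.

(** At the [p_i] the new entries have even valuation by construction; at the other primes not
    dividing [2 * e1 * e2 * e3] evenness comes from solvability of the twist. In both cases
    [lsol_good_even] produces a new point; only at the remaining primes and over the reals is the
    given point transported. *)
Lemma inSel_to_base (e1 e2 e3 : int) (k : nat) (p : 'I_k -> nat) (n : nat) (d1 d2 d3 : int)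
    (delta := fun d : int => (dprod k p (fun j => odd (logn (p j) `|d|)))%:Z) :
  twist_data e1 e2 e3 k p n ->
  inSel e1 e2 e3 n%:Z (d1, d2, d3) ->
  inSel e1 e2 e3 1 (d1 * delta d1, d2 * delta d2, d3 * delta d3).
Proof.
move=> D [/= D1 D2 D3 [W WE] [realS padicS]].
rewrite /t1 /t2 /t3 /= in D1 D2 D3 WE realS padicS.
have pp := td_prime _ _ _ _ _ _ D; have pI := td_inj _ _ _ _ _ _ D.
have nE := dprod_true _ _ _ (td_prod _ _ _ _ _ _ D).
have n0 : (0 < n)%N by rewrite nE dprod_gt0.
have del0 d : 0 < delta d by rewrite ltz_nat dprod_gt0.
have delN d : delta d != 0 by rewrite gt_eqF.
have dd0 d : d != 0 -> d * delta d != 0 by move=> d0; apply: mulf_neq0.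
have [V VE] : exists V : int, delta d1 * delta d2 * delta d3 = V * V.
  by apply: dprod_square3 => j; apply: (logn_square_prod _ _ _ _ W).
have WVE : d1 * delta d1 * (d2 * delta d2) * (d3 * delta d3) = (W * V) * (W * V).
  transitivity ((d1 * d2 * d3) * (delta d1 * delta d2 * delta d3)); first by ring.
  by rewrite WE VE; ring.
have logM q d : d != 0 -> logn q `|d * delta d| = (logn q `|d| + logn q `|delta d|)%N.
  by move=> d0; rewrite abszM lognM // absz_gt0.
split; rewrite /t1 /t2 /t3 /= ?dd0 //; first by exists (W * V).
split; first by apply: real_solvable_untwist realS; rewrite ?del0 // ltz_nat.
move=> q qp; apply/padic_lsol => //.
have /(padic_lsol _ _ _ _ _ _ _ _ qp) sol := padicS q qp; rewrite !mulr1.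
have e0 := td_sum _ _ _ _ _ _ D.
have [/existsP[i /eqP qE]|/existsPn nq] := boolP [exists i, q == p i].
  have [P1 P2 P3] := ndvd_e _ _ _ _ (pp i) (td_ndvd _ _ _ _ _ _ i D).
  have ev d : d != 0 -> ~~ odd (logn (p i) `|d * delta d|).
    by move=> d0; rewrite logM // oddD /delta /= logn_dprod // oddb addbb.
  by rewrite qE; apply: (lsol_good_even _ _ _ _ _ _ _ (W * V)) => //;
    rewrite ?dd0 ?ev //; apply: td_odd D.
have [bad|good] := boolP ((q == 2%N) || (q%:Z %| e1 * e2 * e3)%Z).
  have bad' : q = 2%N \/ (q%:Z %| e1 * e2 * e3)%Z by case/orP: bad => [/eqP|]; [left|right].
  apply: (lsol_untwist _ _ _ _ _ _ _ n%:Z) sol => //; try exact: td_lsq D qp bad'.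
  by rewrite nE; apply: td_lsq D qp bad'.
move: good; rewrite negb_or => /andP[q2 qe].
have qodd : odd q by case: (even_prime qp) q2 => [->|].
have [P1 P2 P3] := ndvd_e _ _ _ _ qp qe.
have qn : ~~ (q%:Z %| n%:Z)%Z by rewrite nE dprod_ndvd.
have uM (e : int) : ~~ (q%:Z %| e)%Z -> ~~ (q%:Z %| e * n%:Z)%Z.
  by move=> ne; rewrite primez_dvdM // negb_or ne.
have [V1 V2 V3] := lsol_even_val _ _ _ _ _ _ _ _ qp (uM _ P1) (uM _ P2) (uM _ P3) D1 D2 D3 WE sol.
have ev d : d != 0 -> ~~ odd (logn q `|d|) -> ~~ odd (logn q `|d * delta d|).
  by move=> d0 H; rewrite logM // oddD /delta /= logn_dprod0 // addbF.
by apply: (lsol_good_even _ _ _ _ _ _ _ (W * V)) => //; rewrite ?dd0 ?ev.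
Qed.

(** * Translation by torsion and representatives modulo torsion *)

Lemma lsol_sq_equiv (p : nat) (f1 f2 f3 x1 x2 x3 r1 r2 r3 : int) : prime p ->
  x1 != 0 -> x2 != 0 -> x3 != 0 -> r1 != 0 -> r2 != 0 -> r3 != 0 ->
  is_square (x1 * r1) -> is_square (x2 * r2) -> is_square (x3 * r3) ->
  lsol p f1 f2 f3 x1 x2 x3 -> lsol p f1 f2 f3 r1 r2 r3.
Proof.
move=> pp X1 X2 X3 R1 R2 R3.
move=> /is_square_neq0-/(_ (mulf_neq0 X1 R1))[w1 Z1 E1].
move=> /is_square_neq0-/(_ (mulf_neq0 X2 R2))[w2 Z2 E2].
move=> /is_square_neq0-/(_ (mulf_neq0 X3 R3))[w3 Z3 E3].
have aux (r x w c : int) : x * r = w * w -> r * (x * c) ^+ 2 = (w * c) ^+ 2 * x.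
  move=> E; transitivity ((x * r) * x * c ^+ 2); first by ring.
  by rewrite E; ring.
apply: (lsol_scale_exact p _ _ _ _ _ _ _ _ _ _ _ _ (w1 * w2 * w3)
  (x1 * (w2 * w3)) (x2 * (w1 * w3)) (x3 * (w1 * w2)) ((w1 * w2 * w3) ^+ 2)) => //;
  rewrite ?mulf_neq0 //; try by ring.
- by rewrite (aux _ _ _ _ E1); ring.
- by rewrite (aux _ _ _ _ E2); ring.
- by rewrite (aux _ _ _ _ E3); ring.
Qed.

(** The other two translations are rotations of [lsol_translate]; square factors such as [m ^+ 2]
    are removed by [lsol_sq_equiv]. *)
Lemma lsol_torsion_mul (p : nat) (e1 e2 e3 m d1 d2 d3 W : int) (T : triple) : prime p ->
  e1 != 0 -> e2 != 0 -> e3 != 0 -> m != 0 -> e1 + e2 + e3 = 0 ->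
  d1 != 0 -> d2 != 0 -> d3 != 0 -> d1 * d2 * d3 = W * W ->
  T \in torsion_triples e1 e2 e3 m ->
  lsol p (e1 * m) (e2 * m) (e3 * m) d1 d2 d3 ->
  lsol p (e1 * m) (e2 * m) (e3 * m) (d1 * t1 T) (d2 * t2 T) (d3 * t3 T).
Proof.
move=> pp E1 E2 E3 m0 e0 D1 D2 D3 WE.
have f0 : e1 * m + e2 * m + e3 * m = 0 by rewrite -!mulrDl e0 mul0r.
rewrite !inE => /or4P[] /eqP -> sol; rewrite /t1 /t2 /t3 /=.
- by rewrite !mulr1.
- have := lsol_translate p _ _ _ _ _ _ W pp D2 D3 D1 _ _ (lsol_rot _ _ _ _ _ _ _ sol).
  move=> /(_ ltac:(rewrite -WE; ring) ltac:(rewrite -f0; ring)) /lsol_rot/lsol_rot.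
  apply: lsol_sq_equiv => //; rewrite ?mulf_neq0 ?oppr_eq0 ?mulf_neq0 //.
  + by exists (e3 * m * d1); ring.
  + by exists (e1 * e3 * m * d2); ring.
  + by exists (e1 * m * d3); ring.
- have := lsol_translate p _ _ _ _ _ _ W pp D1 D2 D3 WE f0 sol.
  apply: lsol_sq_equiv => //; rewrite ?mulf_neq0 ?oppr_eq0 ?mulf_neq0 //.
  + by exists (e2 * e3 * m * d1); ring.
  + by exists (e3 * m * d2); ring.
  + by exists (e2 * m * d3); ring.
- have := lsol_translate p _ _ _ _ _ _ W pp D3 D1 D2 _ _
    (lsol_rot _ _ _ _ _ _ _ (lsol_rot _ _ _ _ _ _ _ sol)).
  move=> /(_ ltac:(rewrite -WE; ring) ltac:(rewrite -f0; ring)) /lsol_rot.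
  apply: lsol_sq_equiv => //; rewrite ?mulf_neq0 ?oppr_eq0 ?mulf_neq0 //.
  + by exists (e2 * m * d1); ring.
  + by exists (e1 * m * d2); ring.
  + by exists (e1 * e2 * m * d3); ring.
Qed.

(** The parity relation on the exponents is what keeps the product of the three entries a square
    when the bits of a representative are flipped. *)
Lemma torsion_twist (e1 e2 e3 m : int) (c : nat) (T := nth (1, 1, 1) (torsion_triples e1 e2 e3 1) c) :
  (c < 4)%N -> exists s1 s2 s3 : bool, s1 (+) s2 (+) s3 = false /\
  nth (1, 1, 1) (torsion_triples e1 e2 e3 m) c =
    (t1 T * m ^+ s1, t2 T * m ^+ s2, t3 T * m ^+ s3).
Proof.
rewrite /T; case: c T => [|[|[|[|//]]]] /= _ _;
  [exists false, false, false | exists true, false, true |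
   exists false, true, true | exists true, true, false];
  by split; rewrite // /t1 /t2 /t3 /=; congr (_, _, _); rewrite ?expr1 ?expr0; ring.
Qed.

Lemma torsion_dvd (e1 e2 e3 : int) (c : nat) (T := nth (1, 1, 1) (torsion_triples e1 e2 e3 1) c) :
  (c < 4)%N ->
  [/\ (t1 T %| e1 * e2 * e3)%Z, (t2 T %| e1 * e2 * e3)%Z & (t3 T %| e1 * e2 * e3)%Z].
Proof.
rewrite /T; case: c T => [|[|[|[|//]]]] /= _ _; rewrite /t1 /t2 /t3 /= ?mulr1 ?dvd1z //;
  split; apply/dvdzP.
- by exists (- (e1 * e2)); ring.
- by exists (- e2); ring.
- by exists (e2 * e3); ring.
- by exists (- e1); ring.
- by exists (e1 * e2); ring.
- by exists (- (e1 * e3)); ring.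
- by exists (e1 * e3); ring.
- by exists (- (e2 * e3)); ring.
- by exists (- e3); ring.
Qed.

(* Modulo squares and primes dividing [m], the torsion triples of the twist by
   [m] are those of the untwisted curve. *)
Lemma torsion_separated_twist (e1 e2 e3 m x1 x2 x3 : int) (c c' : nat)
    (T := nth (1, 1, 1) (torsion_triples e1 e2 e3 m) c)
    (T' := nth (1, 1, 1) (torsion_triples e1 e2 e3 m) c') :
  e1 != 0 -> e2 != 0 -> e3 != 0 -> e1 + e2 + e3 = 0 ->
  ~ has_rat_point_of_order4 e1 e2 1 -> (c < 4)%N -> (c' < 4)%N ->
  0 < m -> 0 < x1 -> 0 < x2 -> 0 < x3 ->
  coprime `|m| `|e1 * e2 * e3| -> coprime `|x1| `|e1 * e2 * e3| ->
  coprime `|x2| `|e1 * e2 * e3| -> coprime `|x3| `|e1 * e2 * e3| ->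
  is_square (x1 * (t1 T * t1 T')) -> is_square (x2 * (t2 T * t2 T')) ->
  is_square (x3 * (t3 T * t3 T')) -> c = c'.
Proof.
move=> E1 E2 E3 e0 no4 c4 c4' m0 X1 X2 X3 Cm C1 C2 C3.
have [s1 [s2 [s3 [_ TE]]]] := torsion_twist e1 e2 e3 m c c4.
have [s1' [s2' [s3' [_ TE']]]] := torsion_twist e1 e2 e3 m c' c4'.
have [d1 d2 d3] := torsion_dvd e1 e2 e3 c c4.
have [d1' d2' d3'] := torsion_dvd e1 e2 e3 c' c4'.
rewrite /T /T' TE TE' /t1 /t2 /t3 /= -/(t1 _) -/(t2 _) -/(t3 _) => S1 S2 S3.
apply: (torsion_separated e1 e2 e3) => //.
have aux (x u u' : int) (s s' : bool) : 0 < x -> coprime `|x| `|e1 * e2 * e3| ->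
    (u %| e1 * e2 * e3)%Z -> (u' %| e1 * e2 * e3)%Z ->
    is_square (x * (u * m ^+ s * (u' * m ^+ s'))) -> is_square (u * u').
  move=> x0 cx du du' S.
  apply: (coprime_square (x * m ^+ s * m ^+ s')).
  - by rewrite !mulr_gt0 // exprn_gt0.
  - rewrite !abszM !coprimeMl !coprimeMr !abszX.
    have cu (a v : int) : (v %| e1 * e2 * e3)%Z -> coprime `|a| `|e1 * e2 * e3| -> coprime `|a| `|v|.
      by rewrite dvdzE; apply: coprime_dvdr.
    have cm (v : int) (r : bool) : (v %| e1 * e2 * e3)%Z -> coprime (`|m| ^ r) `|v|.
      by move=> dv; apply: coprimeXl; apply: cu dv Cm.
    have [A B] := (cu x u du cx, cu x u' du' cx).
    by rewrite A B (cm u s du) (cm u' s du') (cm u s' du) (cm u' s' du').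
  - by move: S; congr is_square; ring.
by split; [apply: aux S1 | apply: aux S2 | apply: aux S3].
Qed.

Lemma dprod_square2 (k : nat) (p : 'I_k -> nat) (b b' : 'I_k -> bool) :
  injective p -> (forall i, prime (p i)) ->
  is_square ((dprod k p b)%:Z * (dprod k p b')%:Z) -> b =1 b'.
Proof.
move=> pI pp [W WE] i.
have := logn_square_prod (p i) 1 _ _ W (pp i) isT (dprod_neq0 _ _ b pp) (dprod_neq0 _ _ b' pp).
rewrite mul1r logn1 /= !logn_dprod // => /(_ WE).
by case: (b i); case: (b' i).
Qed.

Lemma rep_tripleP (k : nat) (p : 'I_k -> nat) (n : nat) (L : triple) :
  injective p -> (forall i, prime (p i)) -> n = (\prod_(i < k) p i)%N ->
  rep_triple n L <-> exists b1 b2 b3 : 'I_k -> bool,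
    L = ((dprod k p b1)%:Z, (dprod k p b2)%:Z, (dprod k p b3)%:Z).
Proof.
move=> pI pp nE; split=> [|[b1 [b2 [b3 ->]]]].
  case: L => [[d1 d2] d3] [[/= P1 V1] [/= P2 V2] [/= P3 V3]].
  rewrite /t1 /t2 /t3 /= in P1 V1 P2 V2 P3 V3.
  exists (fun j => odd (logn (p j) `|d1|)), (fun j => odd (logn (p j) `|d2|)),
    (fun j => odd (logn (p j) `|d3|)).
  rewrite -!(divisor_dprod k p n) //.
  by rewrite !gtz0_abs.
by split; split; rewrite /t1 /t2 /t3 /= ?ltz_nat ?dprod_gt0 //; apply: dprod_dvd.
Qed.

Lemma inSel_bits (e1 e2 e3 m : int) (k : nat) (p : 'I_k -> nat) (b1 b2 b3 : 'I_k -> bool) :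
  injective p -> (forall i, prime (p i)) ->
  inSel e1 e2 e3 m ((dprod k p b1)%:Z, (dprod k p b2)%:Z, (dprod k p b3)%:Z) ->
  forall j, b1 j (+) b2 j (+) b3 j = false.
Proof.
move=> pI pp [_ _ _ [W WE] _] j.
have := logn_square_prod (p j) _ _ _ W (pp j) (dprod_neq0 _ _ b1 pp)
  (dprod_neq0 _ _ b2 pp) (dprod_neq0 _ _ b3 pp) WE.
by rewrite !logn_dprod //; case: (b1 j); case: (b2 j); case: (b3 j).
Qed.

Lemma dprod_ext (k : nat) (p : 'I_k -> nat) (b b' : 'I_k -> bool) :
  b =1 b' -> dprod k p b = dprod k p b'.
Proof. by move=> bb; apply: eq_bigr => j _; rewrite bb. Qed.

Lemma dprod_cst (k : nat) (p : 'I_k -> nat) (n : nat) (s : bool) :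
  n = (\prod_(i < k) p i)%N -> (dprod k p (fun=> s))%:Z = n%:Z ^+ s.
Proof.
move=> nE; case: s; first by rewrite expr1 -(dprod_true _ _ _ nE).
by rewrite expr0 /dprod big1 // => j _; rewrite expn0.
Qed.

(** Modulo squares [n * d] is the complementary divisor [n / d]: multiplication by [n] flips every
    bit. *)
Lemma dprod_complement (k : nat) (p : 'I_k -> nat) (n : nat) (b : 'I_k -> bool) (s : bool) :
  n = (\prod_(i < k) p i)%N ->
  is_square ((dprod k p b)%:Z * n%:Z ^+ s * (dprod k p (fun j => b j (+) s))%:Z).
Proof.
move=> nE; rewrite -(dprod_cst _ p) //.
have [|W WE] := dprod_square3 k p b (fun=> s) (fun j => b j (+) s); last by exists W.
by move=> j; rewrite addbb.
Qed.

Lemma addb3_false (a b c s t u : bool) :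
  a (+) b (+) c = false -> s (+) t (+) u = false ->
  (a (+) s) (+) (b (+) t) (+) (c (+) u) = false.
Proof. by case: a; case: b; case: c; case: s; case: t; case: u. Qed.

Lemma torsion_neq0 (e1 e2 e3 m : int) (T : triple) :
  e1 != 0 -> e2 != 0 -> e3 != 0 -> m != 0 -> T \in torsion_triples e1 e2 e3 m ->
  [/\ t1 T != 0, t2 T != 0 & t3 T != 0].
Proof.
move=> E1 E2 E3 m0; rewrite !inE => /or4P[] /eqP ->; rewrite /t1 /t2 /t3 /=;
  by rewrite ?oppr_eq0 ?mulf_neq0.
Qed.

(** If [L] times its kernel [delta] is a torsion triple [T0] of E, then [L] times the corresponding
    triple of the twist, [T0] with powers [n ^+ s] inserted, is modulo squares [delta] with its bits
    flipped according to [s]. *)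
Lemma inSel_representative (e1 e2 e3 : int) (k : nat) (p : 'I_k -> nat) (n : nat) (L : triple) :
  twist_data e1 e2 e3 k p n ->
  (forall L', inSel e1 e2 e3 1 L' -> exists2 c, (c < 4)%N &
     sq_equiv L' (nth (1, 1, 1) (torsion_triples e1 e2 e3 1) c)) ->
  inSel e1 e2 e3 n%:Z L ->
  exists L', [/\ rep_triple n L', inSel e1 e2 e3 n%:Z L' & pure_equiv e1 e2 e3 n%:Z L L'].
Proof.
case: L => [[d1 d2] d3] D base LSel.
have [c c4 [S1 S2 S3]] := base _ (inSel_to_base _ _ _ _ _ _ _ _ _ D LSel).
have [s1 [s2 [s3 [sx TE]]]] := torsion_twist e1 e2 e3 n%:Z c c4.
set T0 := nth _ (torsion_triples e1 e2 e3 1) c in S1 S2 S3 TE.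
have pp := td_prime _ _ _ _ _ _ D; have pI := td_inj _ _ _ _ _ _ D.
have nE := td_prod _ _ _ _ _ _ D.
have n0 : n%:Z != 0 by rewrite (dprod_true _ _ _ nE) dprod_neq0.
set T := nth (1, 1, 1) (torsion_triples e1 e2 e3 n%:Z) c in TE.
have TT : T \in torsion_triples e1 e2 e3 n%:Z by rewrite mem_nth.
case: (LSel) => /= D1 D2 D3 [W WE] [_ padicS].
rewrite /t1 /t2 /t3 /= in D1 D2 D3 WE S1 S2 S3 padicS.
pose bits (d : int) (s : bool) := fun j => odd (logn (p j) `|d|) (+) s.
have key (d u : int) (s : bool) :
    is_square (d * (dprod k p (fun j => odd (logn (p j) `|d|)))%:Z * u) ->
    is_square (d * (u * n%:Z ^+ s) * (dprod k p (bits d s))%:Z).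
  move=> S; have C := dprod_complement _ p n (fun j => odd (logn (p j) `|d|)) s nE.
  apply: (is_square_cancel (dprod k p (fun j => odd (logn (p j) `|d|)))%:Z).
    exact: dprod_neq0.
  by have := is_squareM _ _ S C; congr is_square; rewrite /bits; ring.
have K1 := key d1 _ s1 S1; have K2 := key d2 _ s2 S2; have K3 := key d3 _ s3 S3.
have [N1 N2 N3] := torsion_neq0 _ _ _ _ _ (td_e1 _ _ _ _ _ _ D) (td_e2 _ _ _ _ _ _ D)
  (td_e3 _ _ _ _ _ _ D) n0 TT.
have Q1 : is_square (d1 * t1 T * (dprod k p (bits d1 s1))%:Z) by rewrite TE.
have Q2 : is_square (d2 * t2 T * (dprod k p (bits d2 s2))%:Z) by rewrite TE.
have Q3 : is_square (d3 * t3 T * (dprod k p (bits d3 s3))%:Z) by rewrite TE.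
exists ((dprod k p (bits d1 s1))%:Z, (dprod k p (bits d2 s2))%:Z, (dprod k p (bits d3 s3))%:Z).
split.
- by apply/(rep_tripleP k p) => //; do 3!eexists.
- apply: inSel_divisors => //.
    move=> j; apply: addb3_false sx.
    exact: (logn_square_prod (p j) _ _ _ _ (pp j) D1 D2 D3 WE).
  move=> i; have /(padic_lsol _ _ _ _ _ _ _ _ (pp i)) sol := padicS (p i) (pp i).
  have := lsol_torsion_mul _ _ _ _ _ _ _ _ _ _ (pp i) (td_e1 _ _ _ _ _ _ D)
    (td_e2 _ _ _ _ _ _ D) (td_e3 _ _ _ _ _ _ D) n0 (td_sum _ _ _ _ _ _ D) D1 D2 D3 WE TT sol.
  by apply: lsol_sq_equiv => //; rewrite ?mulf_neq0 ?dprod_neq0.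
- by exists T.
Qed.

(** Modulo squares the product of [L1] and [L2] is that of [T1] and [T2]. The former is positive and
    coprime to [e1 * e2 * e3], so [torsion_separated_twist] gives [T1 = T2]; divisors of the
    square-free [n] in one square class are then equal. *)
Lemma representative_unique (e1 e2 e3 : int) (k : nat) (p : 'I_k -> nat) (n : nat)
    (L L1 L2 T1 T2 : triple) :
  twist_data e1 e2 e3 k p n -> ~ has_rat_point_of_order4 e1 e2 1 ->
  t1 L != 0 -> t2 L != 0 -> t3 L != 0 ->
  T1 \in torsion_triples e1 e2 e3 n%:Z -> T2 \in torsion_triples e1 e2 e3 n%:Z ->
  rep_triple n L1 -> rep_triple n L2 ->
  sq_equiv (tmul L T1) L1 -> sq_equiv (tmul L T2) L2 -> T1 = T2 /\ L1 = L2.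
Proof.
move=> D no4 Z1 Z2 Z3 M1 M2.
have pp := td_prime _ _ _ _ _ _ D; have pI := td_inj _ _ _ _ _ _ D.
have nE := td_prod _ _ _ _ _ _ D.
have n0 : n%:Z != 0 by rewrite (dprod_true _ _ _ nE) dprod_neq0.
move=> /(rep_tripleP _ _ _ _ pI pp nE)[a1 [a2 [a3 ->]]].
move=> /(rep_tripleP _ _ _ _ pI pp nE)[b1 [b2 [b3 ->]]].
case=> /= A1 A2 A3; case=> /= B1 B2 B3; rewrite /t1 /t2 /t3 /= -/(t1 _) -/(t2 _) -/(t3 _) in A1 A2 A3 B1 B2 B3.
have copD b : coprime `|(dprod k p b)%:Z| `|e1 * e2 * e3|.
  apply: coprime_dvdl (td_coprime _ _ _ _ _ _ D); exact: dprod_dvd.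
have join (d u u' r r' : int) : d != 0 -> is_square (d * u * r) -> is_square (d * u' * r') ->
    is_square (r * r' * (u * u')).
  move=> d0 S S'; apply: (is_square_cancel d) => //.
  by have := is_squareM _ _ S S'; congr is_square; ring.
have T12 : T1 = T2.
  rewrite -(nth_index (1, 1, 1) M1) -(nth_index (1, 1, 1) M2); congr nth.
  apply: (torsion_separated_twist e1 e2 e3 n%:Z ((dprod k p a1)%:Z * (dprod k p b1)%:Z)
    ((dprod k p a2)%:Z * (dprod k p b2)%:Z) ((dprod k p a3)%:Z * (dprod k p b3)%:Z)).
  - exact: td_e1 D.
  - exact: td_e2 D.
  - exact: td_e3 D.
  - exact: td_sum D.
  - exact: no4.
  - by rewrite -[4%N]/(size (torsion_triples e1 e2 e3 n%:Z)) index_mem.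
  - by rewrite -[4%N]/(size (torsion_triples e1 e2 e3 n%:Z)) index_mem.
  - by rewrite lt_neqAle eq_sym n0.
  - by rewrite mulr_gt0 // ltz_nat dprod_gt0.
  - by rewrite mulr_gt0 // ltz_nat dprod_gt0.
  - by rewrite mulr_gt0 // ltz_nat dprod_gt0.
  - exact: td_coprime D.
  - by rewrite abszM coprimeMl !copD.
  - by rewrite abszM coprimeMl !copD.
  - by rewrite abszM coprimeMl !copD.
  - by rewrite !nth_index //; exact: (join _ _ _ _ _ Z1 A1 B1).
  - by rewrite !nth_index //; exact: (join _ _ _ _ _ Z2 A2 B2).
  - by rewrite !nth_index //; exact: (join _ _ _ _ _ Z3 A3 B3).
split=> //; have [N1 N2 N3] := torsion_neq0 _ _ _ _ _ (td_e1 _ _ _ _ _ _ D)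
  (td_e2 _ _ _ _ _ _ D) (td_e3 _ _ _ _ _ _ D) n0 M1.
rewrite -T12 in B1 B2 B3.
have eqd (d u : int) b b' : d != 0 -> u != 0 ->
    is_square (d * u * (dprod k p b)%:Z) -> is_square (d * u * (dprod k p b')%:Z) ->
    dprod k p b = dprod k p b'.
  move=> d0 u0 S S'; apply: dprod_ext; apply: (dprod_square2 _ p) => //.
  by apply: (is_square_trans (d * u)) S'; rewrite ?mulf_neq0 // mulrC.
by rewrite (eqd _ _ _ _ Z1 N1 A1 B1) (eqd _ _ _ _ Z2 N2 A2 B2) (eqd _ _ _ _ Z3 N3 A3 B3).
Qed.

(** * Local conditions as linear algebra over ['F_2] *)

Lemma F2_bool (x : 'F_2) : x = (x != 0)%:R.
Proof. by case: x => [[|[|//]]] lt; apply: val_inj. Qed.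

Lemma F2_addb (a b : bool) : (a (+) b)%:R = a%:R + b%:R :> 'F_2.
Proof. by case: a; case: b; apply: val_inj. Qed.

Lemma F2_bool_inj (a b : bool) : a%:R = b%:R :> 'F_2 -> a = b.
Proof. by case: a; case: b => // /(congr1 val). Qed.

Lemma nonsquare_prod (q k : nat) (u : 'I_k -> int) (b : 'I_k -> bool) : prime q ->
  (forall j, ~~ (q%:Z %| u j)%Z) ->
  (~~ sqb 'F_q (\prod_(j < k) u j ^+ b j)%:~R)%:R =
  \sum_(j < k) (~~ sqb 'F_q (u j)%:~R)%:R * (b j)%:R :> 'F_2.
Proof.
move=> qp uN; suff [] : ~~ (q%:Z %| \prod_(j < k) u j ^+ b j)%Z /\
  (~~ sqb 'F_q (\prod_(j < k) u j ^+ b j)%:~R)%:R =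
  \sum_(j < k) (~~ sqb 'F_q (u j)%:~R)%:R * (b j)%:R :> 'F_2 by [].
have sq1 : sqb 'F_q 1 by apply/sqbP; exists 1; rewrite expr1n.
elim/big_rec2: _ => [|j s x _ [xN <-]].
  by rewrite sq1 dvdz1 /= neq_ltn prime_gt1 ?orbT.
case: (b j); last by rewrite expr0 mul1r mulr0 add0r.
rewrite expr1 mulr1 primez_dvdM // negb_or uN xN; split=> //.
rewrite intrM sqb_mul ?intr_Fp_eq0 //.
by rewrite -F2_addb; case: (sqb _ (u j)%:~R); case: (sqb _ x%:~R).
Qed.

Lemma twist_cofactor (k : nat) (p : 'I_k -> nat) (n : nat) (i : 'I_k) :
  n = (\prod_(j < k) p j)%N -> n = (dprod k p (fun j => j != i) * p i)%N.
Proof.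
move=> ->; rewrite (bigD1 i) //= mulnC; congr muln.
rewrite /dprod [RHS](bigD1 i) //= eqxx expn0 mul1n.
by apply: eq_bigr => j ->; rewrite expn1.
Qed.

Lemma cofactor_ndvd (k : nat) (p : 'I_k -> nat) (i : 'I_k) (b : 'I_k -> bool) :
  injective p -> (forall i, prime (p i)) -> ~~ b i ->
  ~~ ((p i)%:Z %| (dprod k p b)%:Z)%Z.
Proof.
move=> pI pp bi; have := pfactor_dvdn 1 (pp i) (dprod_gt0 k p b pp).
by rewrite expn1 logn_dprod // (negPf bi) dvdzE /= => ->.
Qed.

(** The factor [p i] of the divisor is replaced by [n'] and the others are kept, matching the
    diagonal and off-diagonal entries of row [i] of [A]. *)
Lemma local_unit_dprod (k : nat) (p : 'I_k -> nat) (i : 'I_k) (b : 'I_k -> bool) (n' : int) :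
  injective p -> (forall i, prime (p i)) ->
  local_unit (p i) n' (dprod k p b)%:Z =
  \prod_(j < k) (if j == i then n' else (p j)%:Z) ^+ b j.
Proof.
move=> pI pp; rewrite [RHS](bigD1 i) //= eqxx.
have restE : \prod_(j < k | j != i) (if j == i then n' else (p j)%:Z) ^+ b j =
    (\prod_(j < k | j != i) p j ^ b j)%N%:Z.
  rewrite -[RHS]natz natr_prod; apply: eq_bigr => j /negPf ->.
  by rewrite natz posz_expn.
rewrite restE /local_unit.
have [bi|bi] := boolP (b i); last first.
  rewrite (negPf (cofactor_ndvd _ _ _ _ pI pp bi)) expr0 mul1r.
  by rewrite /dprod (bigD1 i) //= (negPf bi) expn0 mul1n.
have dE : (dprod k p b)%:Z = (\prod_(j < k | j != i) p j ^ b j)%N%:Z * (p i)%:Z.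
  by rewrite -PoszM /dprod (bigD1 i) //= bi expn1 mulnC.
rewrite dE dvdz_mull // mulzK ?expr1 //.
by rewrite eqz_nat -lt0n prime_gt0.
Qed.

Lemma Amat_mul (e1 e2 e3 : int) (k : nat) (p : 'I_k -> nat) (n : nat) (i : 'I_k)
    (b : 'I_k -> bool) :
  twist_data e1 e2 e3 k p n ->
  (Amat p n *m \col_j (b j)%:R) i ord0 =
  (~~ sqb 'F_(p i) (local_unit (p i) (dprod k p (fun j => j != i))%:Z (dprod k p b)%:Z)%:~R)%:R.
Proof.
move=> D; have pp := td_prime _ _ _ _ _ _ D; have pI := td_inj _ _ _ _ _ _ D.
set n' := dprod k p (fun j => j != i).
have n'N : ~~ ((p i)%:Z %| n'%:Z)%Z by apply: cofactor_ndvd => //; rewrite eqxx.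
have pN j : j != i -> ~~ ((p i)%:Z %| (p j)%:Z)%Z.
  by move=> ji; rewrite dvdzE /= dvdn_prime2 // (inj_eq pI) eq_sym.
rewrite local_unit_dprod // nonsquare_prod //; last first.
  by move=> j; case: eqP => [_|/eqP ji]; [apply: n'N | apply: pN].
rewrite mxE; apply: eq_bigr => j _; rewrite !mxE; congr (_ * _).
rewrite (twist_cofactor _ _ _ i (td_prod _ _ _ _ _ _ D)) -/n' PoszM.
have podd := td_odd _ _ _ _ _ _ i D.
case: eqP => [->|/eqP ji]; first by rewrite hilbert_add_self.
by rewrite hilbert_add_unit ?pN.
Qed.

Lemma val_vec_dprod (k : nat) (p : 'I_k -> nat) (b1 b2 b3 : 'I_k -> bool) :
  injective p -> (forall i, prime (p i)) ->
  val_vec p ((dprod k p b1)%:Z, (dprod k p b2)%:Z, (dprod k p b3)%:Z) =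
  col_mx (\col_j (b1 j)%:R) (\col_j (b2 j)%:R).
Proof.
by move=> pI pp; congr col_mx; apply/matrixP => i j; rewrite !mxE /= logn_dprod.
Qed.

Lemma inSel_kernel (e1 e2 e3 : int) (k : nat) (p : 'I_k -> nat) (n : nat)
    (b1 b2 b3 : 'I_k -> bool) :
  twist_data e1 e2 e3 k p n -> (forall j, b1 j (+) b2 j (+) b3 j = false) ->
  inSel e1 e2 e3 n%:Z ((dprod k p b1)%:Z, (dprod k p b2)%:Z, (dprod k p b3)%:Z) <->
  block_mx (Amat p n) 0 0 (Amat p n) *m
    col_mx (\col_j (b1 j)%:R) (\col_j (b2 j)%:R) = 0.
Proof.
move=> D bx; have pp := td_prime _ _ _ _ _ _ D; have pI := td_inj _ _ _ _ _ _ D.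
rewrite mul_block_col !mul0mx addr0 add0r.
have [W WE] := dprod_square3 k p b1 b2 b3 bx.
have local i : lsol (p i) (e1 * n%:Z) (e2 * n%:Z) (e3 * n%:Z)
    (dprod k p b1)%:Z (dprod k p b2)%:Z (dprod k p b3)%:Z <->
    (Amat p n *m \col_j (b1 j)%:R) i ord0 = 0 /\ (Amat p n *m \col_j (b2 j)%:R) i ord0 = 0.
  have [sN1 S1 S2 S3] := td_square _ _ _ _ _ _ i D.
  have [P1 P2 P3] := ndvd_e _ _ _ _ (pp i) (td_ndvd _ _ _ _ _ _ i D).
  have n'N : ~~ ((p i)%:Z %| (dprod k p (fun j => j != i))%:Z)%Z.
    by apply: cofactor_ndvd => //; rewrite eqxx.
  have N2 b : ~~ ((p i)%:Z ^+ 2 %| (dprod k p b)%:Z)%Z.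
    rewrite -posz_expn dvdzE /= pfactor_dvdn ?dprod_gt0 // logn_dprod //.
    by case: (b i).
  (* Modulo squares the third entry is the product of the first two, so its condition follows from
     theirs; this is why two diagonal blocks suffice. *)
  have A3 : (Amat p n *m \col_j (b3 j)%:R) i ord0 =
    (Amat p n *m \col_j (b1 j)%:R) i ord0 + (Amat p n *m \col_j (b2 j)%:R) i ord0.
    rewrite !mxE -big_split /=; apply: eq_bigr => j _; rewrite !mxE -mulrDr -F2_addb.
    by congr (_ * _%:R); move: (bx j); case: (b1 j); case: (b2 j); case: (b3 j).
  move: A3; rewrite !(Amat_mul e1 e2 e3) //.
  have {1 2 3}-> : n%:Z = (dprod k p (fun j => j != i))%:Z * (p i)%:Z.
    by rewrite {1}(twist_cofactor _ _ _ i (td_prod _ _ _ _ _ _ D)) PoszM.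
  have podd := td_odd _ _ _ _ _ _ i D; have e0 := td_sum _ _ _ _ _ _ D.
  rewrite (lsol_twisted _ _ _ _ _ _ _ _ W) //.
  case: (sqb _ _); case: (sqb _ _); case: (sqb _ _) => //= A3;
    split=> [[]|[]] //; move: A3 => /eqP //.
split=> [[_ _ _ _ [_ padicS]]|].
  have K i := (local i).1 ((padic_lsol _ _ _ _ _ _ _ _ (pp i)).1 (padicS _ (pp i))).
  have -> : Amat p n *m \col_j (b1 j)%:R = 0.
    by apply/matrixP => i j; rewrite ord1 (K i).1 mxE.
  have -> : Amat p n *m \col_j (b2 j)%:R = 0.
    by apply/matrixP => i j; rewrite ord1 (K i).2 mxE.
  by rewrite col_mx0.
rewrite -(col_mx0 _ k k) => /eq_col_mx[K1 K2].
apply: inSel_divisors => // i; apply/local; by rewrite K1 K2 mxE.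
Qed.

Theorem theorem2p6 (e1 e2 e3 : int) (k : nat) (p : 'I_k -> nat) (n : nat) :
  e1 != 0 -> e2 != 0 -> e3 != 0 -> e1 + e2 + e3 = 0 ->
  gcdn (gcdn `|e1| `|e2|) `|e3| \in [:: 1%N; 2%N] ->
  injective p -> (forall i, prime (p i)) ->
  n = (\prod_(i < k) p i)%N -> odd n ->
  coprime n `|e1 * e2 * e3| ->
  (forall i (q : nat), prime q -> odd q -> (q %| absz (e1 * e2 * e3)%R)%N ->
     exists x : nat, (x ^ 2 == p i %[mod q])%N) ->
  ~ has_rat_point_of_order4 e1 e2 1 ->
  ~ has_rat_point_of_order4 e1 e2 n%:Z ->
  (forall i, (p i %% 8 = 1)%N) ->
  (* Sel_2(E/Q) = (Z/2Z)^2 *)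
  (exists s : seq triple,
     [/\ size s = 4%N,
         (forall a b, (a < 4)%N -> (b < 4)%N -> a <> b ->
            ~ sq_equiv (nth (1,1,1) s a) (nth (1,1,1) s b)),
         (forall L, L \in s -> inSel e1 e2 e3 1 L) &
         (forall L, inSel e1 e2 e3 1 L -> exists2 L', L' \in s & sq_equiv L L')]) ->
  (* unique representative by positive divisors of n *)
  (forall L, inSel e1 e2 e3 n%:Z L ->
     exists L', [/\ rep_triple n L', inSel e1 e2 e3 n%:Z L',
                    pure_equiv e1 e2 e3 n%:Z L L' &
                    forall L'', rep_triple n L'' -> inSel e1 e2 e3 n%:Z L'' ->
                      pure_equiv e1 e2 e3 n%:Z L L'' -> L'' = L']) /\
  (* the induced map Sel_2'(E^{(n)}) -> ker (A O ; O A) is an F_2-isomorphism *)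
  (forall L, rep_triple n L -> inSel e1 e2 e3 n%:Z L ->
     block_mx (Amat p n) 0 0 (Amat p n) *m val_vec p L = 0) /\
  (forall L L', rep_triple n L -> inSel e1 e2 e3 n%:Z L ->
     rep_triple n L' -> inSel e1 e2 e3 n%:Z L' ->
     val_vec p L = val_vec p L' -> L = L') /\
  (forall v : 'cV['F_2]_(k + k),
     block_mx (Amat p n) 0 0 (Amat p n) *m v = 0 ->
     exists L, [/\ rep_triple n L, inSel e1 e2 e3 n%:Z L & val_vec p L = v]) /\
  (forall L L' L'', rep_triple n L -> inSel e1 e2 e3 n%:Z L ->
     rep_triple n L' -> inSel e1 e2 e3 n%:Z L' ->
     rep_triple n L'' -> inSel e1 e2 e3 n%:Z L'' ->
     pure_equiv e1 e2 e3 n%:Z (tmul L L') L'' ->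
     val_vec p L'' = val_vec p L + val_vec p L').
Proof.
move=> E1 E2 E3 e0 _ pI pp nE _ cop res no4 _ p8 [s [s4 _ sSel cover]].
have D : twist_data e1 e2 e3 k p n by split.
have base := inSel_torsion _ _ _ _ E1 E2 E3 e0 no4 s4 sSel cover.
have repP L : rep_triple n L -> inSel e1 e2 e3 n%:Z L ->
    exists b1 b2 b3 : 'I_k -> bool, (forall j, b1 j (+) b2 j (+) b3 j = false) /\
    L = ((dprod k p b1)%:Z, (dprod k p b2)%:Z, (dprod k p b3)%:Z).
  move=> /(rep_tripleP k p n L pI pp nE)[b1 [b2 [b3 ->]]] LSel.
  by exists b1, b2, b3; split=> //; apply: inSel_bits LSel.
split; [|split; [|split; [|split]]].
- move=> L LSel; have [L' [L'rep L'Sel LL']] := inSel_representative _ _ _ _ _ _ _ D base LSel.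
  exists L'; split=> // L'' L''rep _ [T2 M2 S2]; case: LL' => T1 M1 S1.
  have [Z1 Z2 Z3 _ _] := LSel.
  by have [_ ->] := representative_unique _ _ _ _ _ _ _ _ _ _ _ D no4 Z1 Z2 Z3 M1 M2 L'rep L''rep S1 S2.
- move=> L Lrep LSel; have [b1 [b2 [b3 [bx LE]]]] := repP _ Lrep LSel.
  rewrite LE val_vec_dprod //.
  by apply/(inSel_kernel e1 e2 e3 _ _ _ _ _ b3) => //; rewrite -LE.
- move=> L L' Lrep LSel L'rep L'Sel.
  have [b1 [b2 [b3 [bx ->]]]] := repP _ Lrep LSel.
  have [a1 [a2 [a3 [ax ->]]]] := repP _ L'rep L'Sel.
  rewrite !val_vec_dprod // => /eq_col_mx[/matrixP V1 /matrixP V2].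
  have B1 : b1 =1 a1 by move=> j; apply: F2_bool_inj; have := V1 j ord0; rewrite !mxE.
  have B2 : b2 =1 a2 by move=> j; apply: F2_bool_inj; have := V2 j ord0; rewrite !mxE.
  have B3 : b3 =1 a3.
    by move=> j; move: (bx j) (ax j); rewrite B1 B2; case: (a1 j); case: (a2 j); case: (a3 j); case: (b3 j).
  by rewrite (dprod_ext _ _ _ _ B1) (dprod_ext _ _ _ _ B2) (dprod_ext _ _ _ _ B3).
- move=> v Av.
  pose b1 j := v (lshift k j) ord0 != 0; pose b2 j := v (rshift k j) ord0 != 0.
  pose b3 j := b1 j (+) b2 j.
  have bx j : b1 j (+) b2 j (+) b3 j = false by rewrite addbb.
  have vE : col_mx (\col_j (b1 j)%:R) (\col_j (b2 j)%:R) = v.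
    by rewrite -[v]vsubmxK; congr col_mx; apply/matrixP => i j; rewrite !mxE ord1 -F2_bool.
  exists ((dprod k p b1)%:Z, (dprod k p b2)%:Z, (dprod k p b3)%:Z); split.
  + by apply/(rep_tripleP k p) => //; exists b1, b2, b3.
  + by apply/(inSel_kernel e1 e2 e3) => //; rewrite vE.
  + by rewrite val_vec_dprod.
- move=> L L' L'' Lrep LSel L'rep L'Sel L''rep L''Sel [T TT S].
  have [b1 [b2 [b3 [bx LE]]]] := repP _ Lrep LSel.
  have [a1 [a2 [a3 [ax L'E]]]] := repP _ L'rep L'Sel.
  (* The entries are the square-free kernels of those of [tmul L L']. Thus [M] represents the same
     class with the trivial torsion triple, and uniqueness forces [L'' = M] whatever [T] is. *)
  pose M := ((dprod k p (fun j => b1 j (+) a1 j))%:Z, (dprod k p (fun j => b2 j (+) a2 j))%:Z,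
    (dprod k p (fun j => b3 j (+) a3 j))%:Z) : triple.
  have Mrep : rep_triple n M by apply/(rep_tripleP k p) => //; do 3!eexists.
  have sq b a : is_square ((dprod k p b)%:Z * (dprod k p a)%:Z * 1 *
      (dprod k p (fun j => b j (+) a j))%:Z).
    by rewrite mulr1; apply: dprod_square3 => j; rewrite addbb.
  have SM : sq_equiv (tmul (tmul L L') (1, 1, 1)) M by rewrite LE L'E; split; apply: sq.
  have one_tors : (1, 1, 1) \in torsion_triples e1 e2 e3 n%:Z by rewrite inE eqxx.
  have [Z1 Z2 Z3 _ _] := LSel; have [Z1' Z2' Z3' _ _] := L'Sel.
  have [_ ->] := representative_unique _ _ _ _ _ _ (tmul L L') _ _ _ _ D no4
    (mulf_neq0 Z1 Z1') (mulf_neq0 Z2 Z2') (mulf_neq0 Z3 Z3') TT one_tors L''rep Mrep S SM.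
  rewrite LE L'E !val_vec_dprod // add_col_mx; congr col_mx;
    by apply/matrixP => i j; rewrite !mxE F2_addb.
Qed.
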